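(* Let $(Z,\nu)$ be a matrix gauge space whose matrix gauge $\nu=\{\nu_n\}$ is $\mathbb{C}$-proper. Then there exist a Hilbert space $H$ and a linear map $\phi:Z\to B(H)$ which is completely gauge isometric, i.e. $\|(\operatorname{Re}\phi^{(n)}(z))_+\|_{B(H^n)}=\nu_n(z)$ for all $n$ and all $z\in M_n(Z)$. Moreover: (i) $\phi$ is completely isometric with respect to the norms on $M_n(Z)$ defined by $$\|z\|_n=\nu_{2n}\!\left(\begin{bmatrix}0&2z\\0&0\end{bmatrix}\right),$$ i.e. $\|\phi^{(n)}(z)\|_{B(H^n)}=\|z\|_n$ for all $n$ and $z\in M_n(Z)$; (ii) $\phi$ is a real-complete order embedding when $Z$ is equipped with the matrix cone $Z_{ac}^n=\{z\in M_n(Z):\nu_n(-z)=0\}$ and $B(H)$ with its accretive cones.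
   Context: For a complex vector space $Z$, $M_n(Z)$ denotes the $n\times n$ matrices over $Z$; for scalar matrices $X\in M_{n,k}$ and $A\in M_n(Z)$, $X^*AX\in M_k(Z)$ is defined by matrix multiplication ($X^*$ the conjugate transpose), and $A\oplus B=\begin{bmatrix}A&0\\0&B\end{bmatrix}$. For a linear map $\phi$, $\phi^{(n)}$ denotes its entrywise application to $n\times n$ matrices. A matrix-compatible function on $Z$ is a sequence $\nu=\{\nu_n:M_n(Z)\to[0,\infty)\}$ such that $\nu_k(X^*AX)\le\|X\|^2\nu_n(A)$ for all $A\in M_n(Z)$, $X\in M_{n,k}$, and $\nu_{n+m}(A\oplus B)=\max\{\nu_n(A),\nu_m(B)\}$ for all $A\in M_n(Z)$, $B\in M_m(Z)$. A gauge on a complex vector space is a map $\nu$ to $[0,\infty)$ with $\nu(x+y)\le\nu(x)+\nu(y)$ and $\nu(tx)=t\nu(x)$ for $t\ge 0$. A matrix gauge is a matrix-compatible function each of whose $\nu_n$ is a gauge; $(Z,\nu)$ is then a matrix gauge space. The matrix gauge is $\mathbb{C}$-proper if $\nu_1(i^kz)=0$ for all $k\in\{0,1,2,3\}$ implies $z=0$. For a Hilbert space $H$, $M_n(B(H))$ is identified with $B(H^n)$, $\operatorname{Re}(T)=\frac12(T+T^* )$, $T_+$ is the positive part of a self-adjoint operator $T$, and the accretive cones of $B(H)$ are $\{T\in B(H^n):\operatorname{Re}(T)\ge 0\}$. A cone is a set $C$ with $C+C\subseteq C$, $tC\subseteq C$ for $t\ge0$; a matrix cone in $Z$ is a sequence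 of cones $C_n\subseteq M_n(Z)$ with $X^*C_nX\subseteq C_k$ for all $X\in M_{n,k}$. A linear map $\phi$ between spaces equipped with matrix cones $\{Z_{ac}^n\}$, $\{W_{ac}^n\}$ is real-completely positive if $\phi^{(n)}(Z_{ac}^n)\subseteq W_{ac}^n$ for all $n$; it is a real-complete order embedding if it is injective and both $\phi$ and $\phi^{-1}$ (on the range of $\phi$) are real-completely positive. *)

(* Defs.v *)
From HB Require Import structures.
From mathcomp Require Import all_boot all_order all_algebra.
From mathcomp Require Import classical_sets reals.
From mathcomp Require Export complex.
Set Implicit Arguments. Unset Strict Implicit. Unset Printing Implicit Defensive.
Import Order.TTheory GRing.Theory Num.Theory.
Local Open Scope ring_scope.
Local Open Scope classical_set_scope.
Local Open Scope complex_scope.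

Section Defs.
Variable R : realType.
Local Notation C := R[i].

Definition cabs (x : C) : R := complex.Re `|x|.

Definition vnorm k (v : 'cV[C]_k) : R :=
  Num.sqrt (\sum_(i < k) cabs (v i 0) ^+ 2).

Definition smxnorm n k (X : 'M[C]_(n, k)) : R :=
  sup [set vnorm (X *m v) | v in [set v : 'cV[C]_k | vnorm v <= 1]].

Definition mxcong (Z : lmodType C) n k (X : 'M[C]_(n, k)) (A : 'M[Z]_n)
  : 'M[Z]_k :=
  \matrix_(i < k, j < k)
     \sum_(p < n) \sum_(q < n) (Num.conj (X p i) * X q j) *: A p q.

Definition is_gauge (Z : lmodType C) n (g : 'M[Z]_n -> R) : Prop :=
  [/\ forall x, 0 <= g x,
      forall x y, g (x + y) <= g x + g y &
      forall (t : R) x, 0 <= t -> g (map_mx (fun a => t%:C *: a) x) = t * g x].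

Definition matrix_compatible (Z : lmodType C) (nu : forall n, 'M[Z]_n -> R)
  : Prop :=
  [/\ forall n A, 0 <= nu n A,
      forall n k (A : 'M[Z]_n) (X : 'M[C]_(n, k)),
        nu k (mxcong X A) <= smxnorm X ^+ 2 * nu n A &
      forall n m (A : 'M[Z]_n) (B : 'M[Z]_m),
        nu (n + m)%N (block_mx A 0 0 B) = Num.max (nu n A) (nu m B)].

Definition matrix_gauge (Z : lmodType C) (nu : forall n, 'M[Z]_n -> R) : Prop :=
  matrix_compatible nu /\ forall n, is_gauge (nu n).

Definition C_proper (Z : lmodType C) (nu : forall n, 'M[Z]_n -> R) : Prop :=
  forall z : Z,
    (forall k : nat, (k < 4)%N -> nu 1%N (const_mx ('i ^+ k *: z)) = 0) ->
    z = 0.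

Record hilbert := Hilbert {
  hcarrier :> lmodType C;
  hinner : hcarrier -> hcarrier -> C;
  hinnerDl : forall (a : C) x y z,
      hinner (a *: x + y) z = a * hinner x z + hinner y z;
  hinner_conj : forall x y, hinner y x = Num.conj (hinner x y);
  hinner_ge0 : forall x, 0 <= hinner x x;
  hinner_eq0 : forall x, hinner x x = 0 -> x = 0;
  hcomplete : forall u : nat -> hcarrier,
    (forall e : R, 0 < e -> exists N, forall m n, (N <= m)%N -> (N <= n)%N ->
        Num.sqrt (complex.Re (hinner (u m - u n) (u m - u n))) < e) ->
    exists l, forall e : R, 0 < e -> exists N, forall n, (N <= n)%N ->
        Num.sqrt (complex.Re (hinner (u n - l) (u n - l))) < e
}.

Variable H : hilbert.

Definition hnorm (x : H) : R := Num.sqrt (complex.Re (hinner x x)).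

Definition bounded_op (T : H -> H) : Prop :=
  (forall (a : C) x y, T (a *: x + y) = a *: T x + T y) /\
  exists M : R, forall x, hnorm (T x) <= M * hnorm x.

(** H^n, with vectors 'I_n -> H; B(H^n) is identified with M_n(B(H)) *)
Definition vecH n := 'I_n -> H.
Definition innern n (x y : vecH n) : C := \sum_(i < n) hinner (x i) (y i).
Definition hnormn n (x : vecH n) : R := Num.sqrt (complex.Re (innern x x)).

(* an operator on H^n (intended: a matrix of operators acting on H^n) *)
Definition opn n := vecH n -> vecH n.

Definition mx_act n (T : 'I_n -> 'I_n -> H -> H) : opn n :=
  fun x i => \sum_(j < n) T i j (x j).

Definition opnorm n (T : opn n) : R :=
  sup [set hnormn (T x) | x in [set x : vecH n | hnormn x <= 1]].

Definition is_adjoint n (T S : opn n) : Prop :=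
  forall x y, innern (T x) y = innern x (S y).

Definition linear_opn n (T : opn n) : Prop :=
  forall (a : C) x y, T (fun i => a *: x i + y i) = fun i => a *: T x i + T y i.

Definition bounded_opn n (T : opn n) : Prop :=
  linear_opn T /\ exists M : R, forall x, hnormn (T x) <= M * hnormn x.

(* Re(T) = (T + T^* )/2, given an adjoint S of T *)
Definition ReOp n (T S : opn n) : opn n :=
  fun x i => 2^-1 *: (T x i + S x i).

Definition pos_opn n (A : opn n) : Prop :=
  bounded_opn A /\ forall x, 0 <= innern (A x) x.

(* P is the positive part A_+ of the self-adjoint operator A:
   A = P - N with P, N >= 0 and P N = 0 (the Jordan decomposition). *)
Definition is_pos_part n (A P : opn n) : Prop :=
  exists N : opn n,
    [/\ pos_opn P, pos_opn N,
        forall x, A x = (fun i => P x i - N x i) &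
        forall x, P (N x) = (fun _ => 0)].

Definition re_pos_norm_eq n (T : opn n) (r : R) : Prop :=
  exists S, is_adjoint T S /\
  exists P, is_pos_part (ReOp T S) P /\ opnorm P = r.

Definition accretive n (T : opn n) : Prop :=
  exists S, is_adjoint T S /\ pos_opn (ReOp T S).

End Defs.

Definition ampl (R : realType) (Z : lmodType R[i]) (H : hilbert R)
  (phi : Z -> H -> H) n (z : 'M[Z]_n) : opn H n :=
  mx_act (fun i j => phi (z i j)).

(* Main.v *)
Require Import Defs.
From HB Require Import structures.
From mathcomp Require Import all_boot all_order all_algebra.
From mathcomp Require Import finmap boolp.
From mathcomp Require Import classical_sets reals complex.
From mathcomp Require Import ring lra.
Import Order.TTheory GRing.Theory Num.Theory.
Local Open Scope ring_scope.

(** Let an admissible map be a linear [psi : Z -> M_k] whose amplifications satisfy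
    [Re psi^(m)(w) <= nu_m(w)]; the operator is the direct sum of all admissible maps,
    acting on an l2-sum of finite-dimensional spaces.  Everything follows once
    [nu_n(z)] is the least [c >= 0] bounding the quadratic forms of all the
    [Re psi^(n)(z)] on unit vectors.  To see this, apply Hahn-Banach on the real space [M_n(Z) x M_n(C)] to
      [Q(w, h) = inf {t | (w, h + t 1) \in K}],
      [K = {(X^* u X, h) | nu_k(u) <= 1, X^* X <= h}];
    [K] is a convex cone because [nu(u (+) v) = max (nu u) (nu v)], and
    [nu_n(z) <= Q(z, 0)].  The functional obtained splits as [f(w) - p(h)], with [p] a
    state on [M_n], [nu_n(z) <= f(z)] and [f(X^* w X) <= nu_k(w) p(X^* X)].  The
    complexification of [f], read off in an orthonormal basis for the inner product
    given by [p] (perturbed to be definite), is an admissible map which almost attains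
    [nu_n(z)].  Positive parts are taken blockwise, by the finite-dimensional spectral
    theorem, and the norm of [T] is read off the form of the corner matrix
    [[0 2T; 0 0]]. *)

Set Implicit Arguments. Unset Strict Implicit. Unset Printing Implicit Defensive.

(** * Frobenius inner product *)

Section ComplexParts.
Local Open Scope complex_scope.
Variable R : realType.
Local Notation C := R[i].
Local Notation Re := (@complex.Re R).
Local Notation Im := (@complex.Im R).
Implicit Types x y : C.

Lemma complex_eqP x y : Re x = Re y -> Im x = Im y -> x = y.
Proof. by case: x y => a b [c d] /= -> ->. Qed.

Lemma cReD x y : Re (x + y) = Re x + Re y. Proof. by case: x y => ? ? []. Qed.
Lemma cImD x y : Im (x + y) = Im x + Im y. Proof. by case: x y => ? ? []. Qed.
Lemma cReN x : Re (- x) = - Re x. Proof. by case: x. Qed.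
Lemma cImN x : Im (- x) = - Im x. Proof. by case: x. Qed.
Lemma cReB x y : Re (x - y) = Re x - Re y. Proof. by rewrite cReD cReN. Qed.
Lemma cImB x y : Im (x - y) = Im x - Im y. Proof. by rewrite cImD cImN. Qed.
Lemma cReM x y : Re (x * y) = Re x * Re y - Im x * Im y.
Proof. by case: x y => ? ? []. Qed.
Lemma cImM x y : Im (x * y) = Re x * Im y + Im x * Re y.
Proof. by case: x y => ? ? []. Qed.
Lemma cReZ (t : R) x : Re (t%:C * x) = t * Re x.
Proof. by rewrite cReM /= mul0r subr0. Qed.
Lemma conjE x : Num.conj x = Re x -i* Im x.
Proof. by case: x. Qed.
Lemma cRe_conj x : Re (Num.conj x) = Re x. Proof. by rewrite conjE. Qed.
Lemma cIm_conj x : Im (Num.conj x) = - Im x. Proof. by rewrite conjE. Qed.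
Lemma conj_real (t : R) : Num.conj t%:C = t%:C.
Proof. by rewrite conjE /= oppr0. Qed.

Lemma cRe_sum (I : Type) (r : seq I) (P : pred I) (F : I -> C) :
  Re (\sum_(i <- r | P i) F i) = \sum_(i <- r | P i) Re (F i).
Proof. exact: (big_morph _ cReD). Qed.
Lemma ge0_complexP x : (0 <= x) = (Im x == 0) && (0 <= Re x).
Proof. by rewrite lecE. Qed.

End ComplexParts.

Section Frobenius.
Local Open Scope complex_scope.
Variable R : realType.
Local Notation C := R[i].
Local Notation Re := (@complex.Re R).
Local Notation Im := (@complex.Im R).

Definition adjmx m n (A : 'M[C]_(m, n)) : 'M[C]_(n, m) :=
  \matrix_(i, j) Num.conj (A j i).
Local Notation "A ^H" := (adjmx A) (at level 8, format "A ^H").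

Lemma adjmxE m n (A : 'M[C]_(m, n)) : A^H = map_mx Num.conj A^T.
Proof. by apply/matrixP => i j; rewrite !mxE. Qed.

Lemma adjmx_mul m n p (A : 'M[C]_(m, n)) (B : 'M_(n, p)) :
  (A *m B)^H = B^H *m A^H.
Proof. by rewrite !adjmxE trmx_mul map_mxM. Qed.

Lemma adjmxK m n (A : 'M[C]_(m, n)) : A^H^H = A.
Proof. by apply/matrixP => i j; rewrite !mxE conjCK. Qed.

Definition frob m n (X Y : 'M[C]_(m, n)) : C := \tr (X *m Y^H).
Definition nsq m n (X : 'M[C]_(m, n)) : R := Re (frob X X).

Section Basic.
Variables m n : nat.
Implicit Types X Y W : 'M[C]_(m, n).

Lemma frobE X Y : frob X Y = \sum_i \sum_j X i j * Num.conj (Y i j).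
Proof.
by apply: eq_bigr => i _; rewrite !mxE; apply: eq_bigr => j _; rewrite !mxE.
Qed.

Lemma frobDl X Y W : frob (X + Y) W = frob X W + frob Y W.
Proof. by rewrite /frob mulmxDl mxtraceD. Qed.
Lemma frobZl a X Y : frob (a *: X) Y = a * frob X Y.
Proof. by rewrite /frob -scalemxAl mxtraceZ. Qed.
Lemma frob_conj X Y : frob Y X = Num.conj (frob X Y).
Proof.
rewrite !frobE rmorph_sum; apply: eq_bigr => i _; rewrite rmorph_sum /=.
by apply: eq_bigr => j _; rewrite rmorphM /= conjCK mulrC.
Qed.
Lemma frobDr X Y W : frob W (X + Y) = frob W X + frob W Y.
Proof. by rewrite frob_conj frobDl rmorphD /= -!frob_conj. Qed.
Lemma frobZr a X Y : frob X (a *: Y) = Num.conj a * frob X Y.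
Proof. by rewrite frob_conj frobZl rmorphM /= -!frob_conj. Qed.
Lemma frobNl X Y : frob (- X) Y = - frob X Y.
Proof. by rewrite -scaleN1r frobZl mulN1r. Qed.
Lemma frobBl X Y W : frob (X - Y) W = frob X W - frob Y W.
Proof. by rewrite frobDl frobNl. Qed.
Lemma frob0l X : frob 0 X = 0.
Proof. by rewrite -(scale0r 0) frobZl mul0r. Qed.

Lemma nsqE X : nsq X = \sum_i \sum_j (Re (X i j) ^+ 2 + Im (X i j) ^+ 2).
Proof.
rewrite /nsq frobE cRe_sum; apply: eq_bigr => i _; rewrite cRe_sum.
by apply: eq_bigr => j _; rewrite cReM cRe_conj cIm_conj mulrN opprK !expr2.
Qed.

Lemma nsq_ge0 X : 0 <= nsq X.
Proof.
by rewrite nsqE; do 2!apply: sumr_ge0 => ? _; rewrite addr_ge0 ?sqr_ge0.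
Qed.

Lemma nsq_eq0 X : nsq X = 0 -> X = 0.
Proof.
rewrite nsqE => /eqP; rewrite psumr_eq0; last first.
  by move=> i _; apply: sumr_ge0 => ? _; rewrite addr_ge0 ?sqr_ge0.
move=> /allP X0; apply/matrixP => i j.
have := X0 i (mem_index_enum _); rewrite psumr_eq0; last first.
  by move=> ? _; rewrite addr_ge0 ?sqr_ge0.
move=> /allP/(_ j (mem_index_enum _)).
rewrite /= paddr_eq0 ?sqr_ge0// !sqrf_eq0 mxE => /andP[/eqP Re0 /eqP Im0].
exact: complex_eqP.
Qed.

Lemma frobXX X : frob X X = (nsq X)%:C.
Proof.
apply: complex_eqP => //=; have /(congr1 Im) := frob_conj X X.
by rewrite cIm_conj; lra.
Qed.

Lemma nsqD X Y : nsq (X + Y) = nsq X + nsq Y + 2 * Re (frob X Y).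
Proof.
rewrite /nsq frobDl !frobDr !cReD (frob_conj X Y) cRe_conj.
move: (Re _) (Re _) (Re _) => a b c; lra.
Qed.

Lemma nsqZ (t : R) X : nsq (t%:C *: X) = t ^+ 2 * nsq X.
Proof. by rewrite /nsq frobZl frobZr conj_real !cReZ mulrA. Qed.
Lemma nsqN X : nsq (- X) = nsq X.
Proof. by rewrite /nsq frobNl frob_conj frobNl -rmorphN opprK cRe_conj. Qed.
Lemma nsq0 : nsq (0 : 'M[C]_(m, n)) = 0.
Proof. by rewrite /nsq frob0l. Qed.

Lemma nsqB X Y : nsq (X - Y) = nsq X + nsq Y - 2 * Re (frob X Y).
Proof.
by rewrite nsqD nsqN -[- Y]scaleN1r frobZr rmorphN1 mulN1r cReN mulrN.
Qed.

Lemma nsqD_le X Y : nsq (X + Y) <= 2 * nsq X + 2 * nsq Y.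
Proof. have := nsq_ge0 (X - Y); rewrite nsqB nsqD.
move: (nsq X) (nsq Y) (Re _) => a b c; lra. Qed.

Lemma cRe_frob_le X Y : `|Re (frob X Y)| <= nsq X + nsq Y.
Proof.
have := nsq_ge0 (X - Y); have := nsq_ge0 (X + Y); rewrite nsqB nsqD.
have := nsq_ge0 X; have := nsq_ge0 Y; rewrite ler_norml.
move: (nsq X) (nsq Y) (Re _) => a b c *; apply/andP; split; lra.
Qed.

Lemma cIm_frob_le X Y : `|Im (frob X Y)| <= nsq X + nsq Y.
Proof.
have -> : Im (frob X Y) = Re (frob X ('i%C *: Y)).
  by rewrite frobZr cReM cRe_conj cIm_conj /=; lra.
apply: le_trans (cRe_frob_le _ _) _; rewrite lerD2l.
by rewrite /nsq frobZl frobZr mulrA cReM cImM cReM conjE /=; lra.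
Qed.

(** Cauchy-Schwarz in additive form: expand [0 <= nsq (X - c W)] and divide by [c]. With the
    converse below, it turns an operator bound on squared norms into a bound on a real form, the one
    produced by the corner matrix [[[0 2T; 0 0]]]. *)
Lemma frob_le_of_nsq_le (c : R) X Y W : 0 <= c -> nsq X <= c ^+ 2 * nsq Y ->
  2 * Re (frob X W) <= c * (nsq W + nsq Y).
Proof.
rewrite le_eqVlt => /predU1P[<-|c0 XY].
  rewrite expr0n /= !mul0r => X0; have /nsq_eq0 -> : nsq X = 0.
    by apply/eqP; rewrite eq_le X0 nsq_ge0.
  by rewrite frob0l mulr0.
have := nsq_ge0 (X - c%:C *: W); rewrite nsqB nsqZ frobZr conj_real cReZ => h.
rewrite -(ler_pM2l c0); move: h XY; rewrite expr2.
move: (nsq X) (nsq Y) (nsq W) (Re _) => a b d f *; lra.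
Qed.

(** Only multiples of [X] itself are tested. The choice [t = 1 / c] gives the sharp constant; when
    [c = 0], already [t = 1] forces [nsq X = 0]. *)
Lemma nsq_le_of_frob_le (c : R) X Y : 0 <= c ->
  (forall t : R, 2 * Re (frob X (t%:C *: X)) <= c * (nsq (t%:C *: X) + nsq Y)) ->
  nsq X <= c ^+ 2 * nsq Y.
Proof.
move=> c0 h; have {}h t : 2 * (t * nsq X) <= c * (t ^+ 2 * nsq X + nsq Y).
  by have := h t; rewrite frobZr conj_real cReZ nsqZ.
move: c0; rewrite le_eqVlt => /predU1P[c0|c0].
  by have := h 1; rewrite -c0; move: (nsq X) (nsq Y) => *; lra.
have c_neq0 : c != 0 by rewrite gt_eqF.
have := h c^-1; rewrite -(ler_pM2l c0).
move: (nsq X) (nsq Y) => a b.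
have -> : c * (2 * (c^-1 * a)) = 2 * a by field.
have -> : c * (c * (c^-1 ^+ 2 * a + b)) = a + c ^+ 2 * b by field.
by move: (_ * b) => *; lra.
Qed.

(** The additive bound on [2 Re <T X, Y>] is symmetric in the squared norms of [X] and [Y], so it
    passes to the adjoint with the same constant. *)
Lemma adjoint_nsq_le (c : R) (T S : 'M[C]_(m, n) -> 'M[C]_(m, n)) : 0 <= c ->
  (forall X, nsq (T X) <= c ^+ 2 * nsq X) ->
  (forall X Y, frob (T X) Y = frob X (S Y)) ->
  forall Y, nsq (S Y) <= c ^+ 2 * nsq Y.
Proof.
move=> c0 Tc TS Y; apply: nsq_le_of_frob_le => // t.
rewrite frob_conj -TS cRe_conj addrC.
exact: frob_le_of_nsq_le c0 (Tc _).
Qed.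

End Basic.

Lemma frob_mulmxl m n k (X : 'M[C]_(m, n)) (A : 'M_(n, k)) Y :
  frob (X *m A) Y = frob X (Y *m A^H).
Proof.
by rewrite /frob adjmx_mul adjmxK mulmxA.
Qed.

Lemma frob_rows m n (X Y : 'M[C]_(m, n)) :
  frob X Y = \sum_p frob (row p X) (row p Y).
Proof.
rewrite frobE; apply: eq_bigr => p _; rewrite frobE big_ord1.
by apply: eq_bigr => j _; rewrite !mxE.
Qed.

Lemma frob_mxvec m n (X Y : 'M[C]_(m, n)) : frob (mxvec X) (mxvec Y) = frob X Y.
Proof.
rewrite !frobE big_ord1 (reindex _ (curry_mxvec_bij _ _)) /=.
by rewrite pair_bigA; apply: eq_bigr => -[i j] _; rewrite !mxvecE.
Qed.

Lemma nsq_mxvec m n (X : 'M[C]_(m, n)) : nsq (mxvec X) = nsq X.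
Proof. by rewrite /nsq frob_mxvec. Qed.

Lemma frob_col_mx m1 m2 n (X1 Y1 : 'M[C]_(m1, n)) (X2 Y2 : 'M_(m2, n)) :
  frob (col_mx X1 X2) (col_mx Y1 Y2) = frob X1 Y1 + frob X2 Y2.
Proof.
rewrite !frobE big_split_ord; congr (_ + _); apply: eq_bigr => i _;
  apply: eq_bigr => j _; by rewrite ?col_mxEu ?col_mxEd.
Qed.

Lemma nsq_rows m n (X : 'M[C]_(m, n)) : nsq X = \sum_p nsq (row p X).
Proof. by rewrite /nsq frob_rows cRe_sum. Qed.

Lemma nsq_row_le m n (X : 'M[C]_(m, n)) p : nsq (row p X) <= nsq X.
Proof.
rewrite [leRHS]nsq_rows (bigD1 p) //= lerDl; apply: sumr_ge0 => q _; exact: nsq_ge0.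
Qed.

Lemma nsq_entry_le m n (X : 'M[C]_(m, n)) i j :
  Re (X i j) ^+ 2 + Im (X i j) ^+ 2 <= nsq X.
Proof.
rewrite nsqE (bigD1 i) //= (bigD1 j) //= -addrA lerDl addr_ge0 //.
  by apply: sumr_ge0 => ? _; rewrite addr_ge0 ?sqr_ge0.
by do 2!apply: sumr_ge0 => ? _; rewrite addr_ge0 ?sqr_ge0.
Qed.

End Frobenius.

(** * Jordan decomposition in finite dimension *)

Section FiniteSpectral.
Local Open Scope complex_scope.
Variable R : realType.
Local Notation C := R[i].
Local Notation Re := (@complex.Re R).
Local Notation Im := (@complex.Im R).
Local Notation "A ^H" := (adjmx A) (at level 8, format "A ^H").

Section FunctionalCalculus.
Variables (N : nat) (U : 'M[C]_N).
Hypothesis UU : U *m U^H = 1%:M.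

Definition rdiag (e : 'I_N -> R) : 'M[C]_N := diag_mx (\row_j (e j)%:C).

(** Matrices act on row vectors from the right, so the rows of [U] are the eigenvectors, with
    eigenvalues [e]. *)
Definition fcalc (e : 'I_N -> R) : 'M[C]_N := U^H *m rdiag e *m U.

Lemma rdiag_adj e : (rdiag e)^H = rdiag e.
Proof.
apply/matrixP => i j; rewrite !mxE eq_sym; case: eqP => [->|_].
  by rewrite !mulr1n conj_real.
by rewrite !mulr0n rmorph0.
Qed.

Lemma rdiagM e e' : rdiag e *m rdiag e' = rdiag (fun j => e j * e' j).
Proof.
rewrite /rdiag mulmx_diag; apply/matrixP => i j.
by rewrite !mxE rmorphM.
Qed.

Lemma rdiagB e e' : rdiag e - rdiag e' = rdiag (fun j => e j - e' j).
Proof. by apply/matrixP => i j; rewrite !mxE rmorphB mulrnBl. Qed.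

Lemma fcalc_adj e : (fcalc e)^H = fcalc e.
Proof. by rewrite /fcalc !adjmx_mul adjmxK rdiag_adj mulmxA. Qed.

Lemma fcalcM e e' : fcalc e *m fcalc e' = fcalc (fun j => e j * e' j).
Proof.
by rewrite /fcalc -rdiagM !mulmxA -(mulmxA _ U) UU mulmx1.
Qed.

Lemma eq_fcalc e e' : e =1 e' -> fcalc e = fcalc e'.
Proof. by move=> /funext ->. Qed.

Lemma fcalcB e e' : fcalc e - fcalc e' = fcalc (fun j => e j - e' j).
Proof. by rewrite /fcalc -rdiagB mulmxBr mulmxBl. Qed.

Lemma fcalc0 : fcalc (fun=> 0) = 0.
Proof.
rewrite -(subrr (fcalc (fun=> 1))) fcalcB.
by apply: eq_fcalc => j; rewrite subrr.
Qed.

Lemma frob_fcalc e (v : 'rV[C]_N) :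
  frob (v *m fcalc e) v =
    (\sum_j e j * (Re ((v *m U^H) 0 j) ^+ 2 + Im ((v *m U^H) 0 j) ^+ 2))%:C.
Proof.
rewrite /fcalc !mulmxA frob_mulmxl frobE big_ord1 rmorph_sum /=.
apply: eq_bigr => j _; rewrite /rdiag mul_mx_diag.
rewrite [X in X * _]mxE [X in _ * X * _]mxE; set x := (v *m _) 0 j.
by apply: complex_eqP; rewrite !(cReM, cImM, cRe_conj, cIm_conj) /=; ring.
Qed.

Lemma nsq_fcalc e (v : 'rV[C]_N) :
  nsq (v *m fcalc e) =
    \sum_j e j ^+ 2 * (Re ((v *m U^H) 0 j) ^+ 2 + Im ((v *m U^H) 0 j) ^+ 2).
Proof.
by rewrite /nsq frob_mulmxl fcalc_adj frob_conj -mulmxA fcalcM cRe_conj frob_fcalc.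
Qed.

Lemma fcalc1 : fcalc (fun=> 1) = 1%:M.
Proof.
rewrite /fcalc (_ : rdiag _ = 1%:M) ?mulmx1; first exact: mulmx1C.
by apply/matrixP => i j; rewrite !mxE.
Qed.

Lemma nsq_spectral (v : 'rV[C]_N) :
  nsq v = \sum_j (Re ((v *m U^H) 0 j) ^+ 2 + Im ((v *m U^H) 0 j) ^+ 2).
Proof.
rewrite -[in LHS](mulmx1 v) -fcalc1 nsq_fcalc; apply: eq_bigr => j _.
by rewrite expr1n mul1r.
Qed.

(** Evaluating the form at an eigenvector recovers the eigenvalue; this is how bounds on forms
    become bounds on spectra. *)
Lemma frob_fcalc_row e j : Re (frob (row j U *m fcalc e) (row j U)) = e j.
Proof.
rewrite frob_fcalc /= (bigD1 j) //= -row_mul UU big1 => [|k /negPf kj].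
  by rewrite !mxE eqxx /= expr1n expr0n /= !addr0 mulr1.
by rewrite !mxE eq_sym kj /= expr0n /= addr0 mulr0.
Qed.

Lemma nsq_row_unitary j : nsq (row j U) = 1.
Proof.
by have := frob_fcalc_row (fun=> 1) j; rewrite fcalc1 mulmx1.
Qed.

End FunctionalCalculus.

Lemma hermitian_fcalc N (A : 'M[C]_N) : A^H = A ->
  exists (U : 'M[C]_N) (d : 'I_N -> R), U *m U^H = 1%:M /\ A = fcalc U d.
Proof.
move=> AH.
have hA : A \is hermsymmx.
  by apply/is_hermitianmxP; rewrite expr0 scale1r -adjmxE AH.
have /orthomx_spectralP A_eq := hermitian_normalmx hA.
have /mxOverP dR := hermitian_spectral_diag_real hA.
have Uu := spectral_unitarymx A.
move: A_eq dR Uu; move: (spectralmx A) (spectral_diag A) => U D A_eq dR Uu.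
have UV : invmx U = U^H by rewrite adjmxE invmx_unitary.
exists U, (fun j => Re (D 0 j)); split.
  by rewrite -UV mulmxV // unitarymx_unit.
have DE : \row_j (Re (D 0 j))%:C = D.
  apply/rowP => j; rewrite mxE; move: (dR 0 j); case: (D 0 j) => x y.
  by rewrite complex_real => /eqP ->.
by rewrite /fcalc /rdiag DE -UV.
Qed.

(** The lower bound makes every eigenvalue positive; [S] and [T] are the square root of [G] and its
    inverse. They serve as the change to an orthonormal basis for the inner product with Gram matrix
    [G]. *)
Lemma hermitian_factor N (G : 'M[C]_N) (e : R) : G^H = G -> 0 < e ->
  (forall v : 'rV[C]_N, e * nsq v <= Re (frob (v *m G) v)) ->
  exists S T : 'M[C]_N, [/\ S *m T = 1%:M, T *m S = 1%:M & S *m S^H = G].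
Proof.
move=> /hermitian_fcalc[U [d [UU ->]]] e0 Ge.
have d0 j : 0 < d j.
  have := Ge (row j U); rewrite nsq_row_unitary // frob_fcalc_row // mulr1.
  exact: lt_le_trans.
have sd0 j : Num.sqrt (d j) != 0 by rewrite sqrtr_eq0 -ltNge.
exists (fcalc U (fun j => Num.sqrt (d j))).
exists (fcalc U (fun j => (Num.sqrt (d j))^-1)).
rewrite fcalc_adj !(fcalcM UU) -(fcalc1 UU); split; apply: eq_fcalc => j /=.
- by rewrite divff.
- by rewrite mulVf.
- by rewrite -expr2 sqr_sqrtr // ltW.
Qed.

Lemma linear_mxE m k (T : 'M[C]_(m, k) -> 'M[C]_(m, k)) : linear T ->
  exists A, forall X, T X = vec_mx (mxvec X *m A).
Proof.
move=> linT.
pose mix := GRing.isLinear.Build _ _ _ _ T linT.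
pose T' : {linear _ -> _} := HB.pack T mix.
by exists (lin_mx T') => X; rewrite mul_vec_lin mxvecK.
Qed.

Lemma adjoint_exists m k (T : 'M[C]_(m, k) -> 'M[C]_(m, k)) : linear T ->
  exists2 S, linear S & forall X Y, frob (T X) Y = frob X (S Y).
Proof.
move=> /linear_mxE[A TA]; exists (fun X => vec_mx (mxvec X *m A^H)).
  by move=> a X Y; rewrite linearP mulmxDl -scalemxAl linearP.
move=> X Y; rewrite TA -frob_mxvec vec_mxK frob_mulmxl.
by rewrite -[in RHS]frob_mxvec vec_mxK.
Qed.

(** The version of [is_pos_part] for one block. The explicit norm bounds are kept so that
    decompositions of infinitely many blocks can be summed. *)
Definition jordan_decomposition m k (T P N : 'M[C]_(m, k) -> 'M[C]_(m, k)) (b c : R) :=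
  [/\ linear P /\ linear N,
      forall X, T X = P X - N X /\ P (N X) = 0,
      forall X, 0 <= frob (P X) X /\ 0 <= frob (N X) X,
      forall X, nsq (P X) <= c ^+ 2 * nsq X &
      forall X, nsq (N X) <= b ^+ 2 * nsq X].

(** The form bounds place the spectrum of [T] in [[-b, c]]; the functions [max (d, 0)] and
    [max (- d, 0)] of the eigenvalues then lie in [[0, c]] and [[0, b]] and have product zero. *)
Lemma jordan_decomposition_exists m k (T : 'M[C]_(m, k) -> 'M[C]_(m, k)) (b c : R) :
  0 <= b -> 0 <= c -> linear T ->
  (forall X Y, frob (T X) Y = frob X (T Y)) ->
  (forall X, - b * nsq X <= Re (frob (T X) X) <= c * nsq X) ->
  exists P N, jordan_decomposition T P N b c.
Proof.
move=> b0 c0 /linear_mxE[A TA] Tsa Tbc.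
have frobA (v w : 'rV_(m * k)) : frob (v *m A) w = frob v (w *m A).
  have := Tsa (vec_mx v) (vec_mx w).
  by rewrite !TA !vec_mxK -[LHS]frob_mxvec -[RHS]frob_mxvec !vec_mxK.
(* Self-adjointness of [T] is symmetry of the form of [A], read entrywise on the standard basis. *)
have AH : A^H = A.
  have rowA (i j : 'I_(m * k)) :
      frob (delta_mx 0 i *m A) (delta_mx 0 j : 'rV_(m * k)) = A i j.
    rewrite -rowE frobE big_ord1 (bigD1 j) //= big1 => [|p /negPf pj].
      by rewrite !mxE !eqxx rmorph1 mulr1 addr0.
    by rewrite !mxE pj andbF rmorph0 mulr0.
  apply/matrixP => i j; rewrite mxE -[in LHS]rowA -[RHS]rowA.
  by rewrite frobA [RHS]frob_conj.
have [U [d [UU A_eq]]] := hermitian_fcalc AH.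
have dbc j : - b <= d j <= c.
  have := Tbc (vec_mx (row j U)); rewrite TA vec_mxK -frob_mxvec.
  rewrite -nsq_mxvec !vec_mxK A_eq frob_fcalc_row // nsq_row_unitary //.
  by rewrite !mulr1.
pose F e X := vec_mx (mxvec X *m fcalc U e) : 'M[C]_(m, k).
have linF e : linear (F e).
  by move=> a X Y; rewrite /F linearP mulmxDl -scalemxAl linearP.
have F_ge0 e : (forall j, 0 <= e j) -> forall X, 0 <= frob (F e X) X.
  move=> e0 X; rewrite -frob_mxvec /F vec_mxK frob_fcalc // ler0c.
  by apply: sumr_ge0 => j _; rewrite mulr_ge0 ?addr_ge0 ?sqr_ge0.
have F_le e r : (forall j, 0 <= e j <= r) -> forall X,
    nsq (F e X) <= r ^+ 2 * nsq X.
  move=> er X; rewrite -(nsq_mxvec X) -(nsq_mxvec (F e X)) /F vec_mxK nsq_fcalc //.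
  rewrite (nsq_spectral UU) mulr_sumr; apply: ler_sum => j _.
  have /andP[e0 re] := er j.
  by rewrite ler_wpM2r ?addr_ge0 ?sqr_ge0 // lerXn2r ?nnegrE // (le_trans e0).
exists (F (fun j => Num.max (d j) 0)), (F (fun j => Num.max (- d j) 0)); split.
- by split.
- move=> X; split.
    rewrite /F -raddfB -mulmxBr fcalcB TA A_eq.
    rewrite (@eq_fcalc _ _ _ d) // => j.
    by rewrite /= /Num.max; do !case: ifPn; lra.
  rewrite /F vec_mxK -mulmxA (fcalcM UU) (@eq_fcalc _ _ _ (fun=> 0)) => [|j].
    by rewrite fcalc0 mulmx0 linear0.
  by rewrite /= /Num.max; do !case: ifPn; nra.
- by move=> X; split; apply: F_ge0 => j; rewrite le_max lexx orbT.
- apply: F_le => j; rewrite le_max lexx orbT /= ge_max c0 andbT.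
  by have /andP[] := dbc j.
- apply: F_le => j; rewrite le_max lexx orbT /= ge_max b0 andbT lerNl.
  by have /andP[] := dbc j.
Qed.

End FiniteSpectral.

(** * Hahn-Banach theorem *)

Section HahnBanach.
Local Open Scope classical_set_scope.
Variables (R : realType) (E : lmodType R).
Implicit Types (p q : E -> R) (x y z : E).

(** Homogeneity is asked only as an inequality, which is easy to verify for infima; applying it to
    [t^-1] as well gives the equality in [sublinearZ]. *)
Definition sublinear q :=
  (forall x y, q (x + y) <= q x + q y) /\
  (forall (t : R) x, 0 < t -> q (t *: x) <= t * q x).

Lemma inf_le_mem (A : set R) (b a : R) :
  (forall u, A u -> b <= u) -> A a -> inf A <= a.
Proof. by move=> lbA Aa; apply: ge_inf => //; exists b => u /lbA. Qed.

Lemma inf_approx (A : set R) (b e : R) : (exists a, A a) ->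
  (forall u, A u -> b <= u) -> 0 < e -> exists2 a, A a & a < inf A + e.
Proof.
by move=> A0 lbA e0; apply: inf_adherent => //; split => //; exists b => u /lbA.
Qed.

Lemma sublinearZ q (t : R) x : sublinear q -> 0 < t -> q (t *: x) = t * q x.
Proof.
move=> [_ qZ] t0; apply/eqP; rewrite eq_le qZ //=.
have := qZ t^-1 (t *: x); rewrite invr_gt0 scalerA mulVf ?gt_eqF // scale1r.
by move=> /(_ t0); rewrite -(ler_pM2l t0) mulrA divff ?gt_eqF // mul1r.
Qed.

Lemma sublinear0 q : sublinear q -> q 0 = 0.
Proof.
move=> sq; have := @sublinearZ q 2 0 sq (ltr0Sn R 1); rewrite scaler0; lra.
Qed.

Lemma sublinear_ge q x : sublinear q -> - q (- x) <= q x.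
Proof.
move=> sq; have [qD _] := sq; have := qD x (- x).
by rewrite subrr (sublinear0 sq); lra.
Qed.

(** Take [q' x] to be the infimum over [t >= 0] of [q (x + t z) - t q z]: [t = 0] gives [q' <= q],
    and [t = 1] gives the value at [- z]. It is used twice, to show that a minimal functional is
    additive and to attain a prescribed value. *)
Lemma sublinear_shift q z : sublinear q ->
  exists q', [/\ sublinear q', forall x, q' x <= q x & q' (- z) <= - q z].
Proof.
move=> sq; have [qD qZ] := sq.
pose A x := [set u | exists2 t : R, 0 <= t & u = q (x + t *: z) - t * q z].
have qZ0 (t : R) x : 0 <= t -> q (t *: x) = t * q x.
  rewrite le_eqVlt => /predU1P[<-|t0]; last exact: sublinearZ.
  by rewrite scale0r mul0r sublinear0.
have lbA x u : A x u -> - q (- x) <= u.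
  move=> [t t0 ->]; have := qD (x + t *: z) (- x).
  by rewrite addrAC subrr add0r qZ0 //; lra.
have memA x : exists a, A x a.
  by exists (q (x + 0 *: z) - 0 * q z), 0.
exists (fun x => inf (A x)); split.
- split=> [x y|t x t0].
    apply/ler_addgt0Pr => e e0.
    have e20 : 0 < e / 2 by rewrite divr_gt0.
    have [_ [t t0 ->] ht] := inf_approx (memA x) (lbA x) e20.
    have [_ [s s0 ->] hs] := inf_approx (memA y) (lbA y) e20.
    have : inf (A (x + y)) <= q (x + y + (t + s) *: z) - (t + s) * q z.
      by apply: inf_le_mem (lbA _) _; exists (t + s); rewrite ?addr_ge0.
    have := qD (x + t *: z) (y + s *: z).
    rewrite scalerDl addrACA; lra.
  rewrite -ler_pdivrMl //; apply/ler_addgt0Pr => e e0.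
  have [_ [s s0 ->] hs] := inf_approx (memA x) (lbA x) e0.
  apply: le_trans (ltW hs); rewrite ler_pdivrMl //.
  apply: inf_le_mem (lbA _) _; exists (t * s); first by rewrite mulr_ge0 // ltW.
  by rewrite -scalerA -scalerDr sublinearZ // mulrBr mulrA.
- move=> x; apply: inf_le_mem (lbA _) _; exists 0 => //.
  by rewrite scale0r mul0r subr0 addr0.
- apply: inf_le_mem (lbA _) _; exists 1 => //.
  by rewrite scale1r addNr (sublinear0 sq) mul1r sub0r.
Qed.

(* A pointwise minimal sublinear functional is linear, since no shift of it can
   be strictly smaller. *)
Lemma sublinear_minorant p : sublinear p ->
  exists q, [/\ sublinear q, forall x, q x <= p x &
    forall x y, q (x + y) = q x + q y].
Proof.
move=> sp.
pose T := {q : E -> R | sublinear q /\ forall x, q x <= p x}.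
pose mkT q sq qp : T := exist _ q (conj sq qp).
(* The order is reversed, so that a maximal element for Zorn's lemma is a pointwise minimal
   functional. *)
pose le_T (q r : T) := `[< forall x, sval r x <= sval q x >].
have [||||[q [sq qp]] qmin] := @Zorn T le_T.
- by move=> q; apply/asboolP.
- move=> q r s /asboolP qr /asboolP rs; apply/asboolP => x.
  exact: le_trans (rs x) (qr x).
- move=> [q hq] [r hr] /asboolP qr /asboolP rq; apply: eq_exist => /=.
  by apply/funext => x; apply/eqP; rewrite eq_le rq qr.
- move=> A Atot; have [[q0 Aq0]|A0] := pselect (exists q : T, A q); last first.
    exists (mkT p sp (fun x => lexx _)) => s As.
    by exfalso; apply: A0; exists s.
  (* A nonempty chain is bounded by its pointwise infimum. Subadditivity survives because of two
     members of the chain one lies below the other. *)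
  pose V x := [set u | exists2 q : T, A q & u = sval q x].
  have lbV x u : V x u -> - p (- x) <= u.
    move=> [[q [sq qp]] _ ->] /=; apply: le_trans (sublinear_ge x sq).
    by rewrite lerN2.
  have memV x : exists a, V x a by exists (sval q0 x), q0.
  have sV : sublinear (fun x => inf (V x)).
    split=> [x y|t x t0].
      apply/ler_addgt0Pr => e e0.
      have e20 : 0 < e / 2 by rewrite divr_gt0.
      have [_ [q Aq ->] hq] := inf_approx (memV x) (lbV x) e20.
      have [_ [r Ar ->] hr] := inf_approx (memV y) (lbV y) e20.
      have [s [As sx sy]] : exists s : T, [/\ A s, sval s x <= sval q x &
                                          sval s y <= sval r y].
        by have [/asboolP h|/asboolP h] := Atot q r Aq Ar; [exists r|exists q].
      have : inf (V (x + y)) <= sval s (x + y).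
        by apply: inf_le_mem (lbV _) _; exists s.
      have [[sD _] _] := svalP s; have := sD x y; lra.
    rewrite -ler_pdivrMl //; apply/ler_addgt0Pr => e e0.
    have [_ [s As ->] hs] := inf_approx (memV x) (lbV x) e0.
    apply: le_trans (ltW hs); rewrite ler_pdivrMl //.
    apply: inf_le_mem (lbV _) _; exists s => //.
    by have [ss _] := svalP s; rewrite sublinearZ.
  have Vp x : inf (V x) <= p x.
    have [_ q0p] := svalP q0; apply: le_trans (q0p x).
    by apply: inf_le_mem (lbV _) _; exists q0.
  exists (mkT _ sV Vp) => s As; apply/asboolP => x /=.
  by apply: inf_le_mem (lbV _) _; exists s.
exists q; split => // x y; apply/eqP; rewrite eq_le; have [qD _] := sq.
rewrite qD /=.
(* By minimality the shift along [y] equals [q], so [q (- y) <= - q y]; subadditivity at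
   [(x + y) + (- y)] then gives the missing inequality. *)
have [q' [sq' q'q q'y]] := sublinear_shift y sq.
have q'p x' : q' x' <= p x' by apply: le_trans (qp x').
have /(congr1 sval) /= qq' : mkT q sq qp = mkT q' sq' q'p.
  by apply/esym/qmin/asboolP.
have := qD (x + y) (- y); rewrite addrK; move: q'y; rewrite -qq'; lra.
Qed.

(** Shifting [p] along [z] first means that every additive minorant [L] of the shift has
    [L (- z) <= - p z], that is [p z <= L z]. *)
Theorem hahn_banach p z : sublinear p ->
  exists L : E -> R, [/\ forall x y, L (x + y) = L x + L y,
    forall (t : R) x, L (t *: x) = t * L x, forall x, L x <= p x & L z = p z].
Proof.
move=> sp; have [p' [sp' p'p p'z]] := sublinear_shift z sp.
have [L [sL Lp' LD]] := sublinear_minorant sp'.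
have LN x : L (- x) = - L x.
  by have := LD x (- x); rewrite subrr (sublinear0 sL); lra.
have Lp x : L x <= p x by apply: le_trans (p'p x).
exists L; split => //.
- move=> t x; case: (ltrgtP t 0) => [t0|t0|->]; last 2 first.
  + exact: sublinearZ.
  + by rewrite scale0r mul0r sublinear0.
  by rewrite -[t]opprK scaleNr LN sublinearZ ?oppr_gt0 // [RHS]mulNr.
- apply/eqP; rewrite eq_le Lp /=; have := le_trans (Lp' (- z)) p'z.
  by rewrite LN lerN2.
Qed.

End HahnBanach.

(** * Congruences and amplifications *)

Section RealScalars.
Local Open Scope complex_scope.
Variables (R : realType) (W : lmodType R[i]) (n : nat).

(* Alias carrying the scalar multiplication by reals, for the Hahn-Banach theorem. *)
Definition rmodmx := 'M[W]_n.
HB.instance Definition _ := GRing.Zmodule.on rmodmx.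

Definition rscale (t : R) (A : rmodmx) : rmodmx :=
  map_mx (fun a => t%:C *: a) (A : 'M[W]_n).

Fact rscaleA s t A : rscale s (rscale t A) = rscale (s * t) A.
Proof. by apply/matrixP => i j; rewrite !mxE scalerA rmorphM. Qed.
Fact rscale1 : left_id 1 rscale.
Proof. by move=> A; apply/matrixP => i j; rewrite !mxE scale1r. Qed.
Fact rscaleDr : right_distributive rscale +%R.
Proof. by move=> t A B; apply/matrixP => i j; rewrite !mxE scalerDr. Qed.
Fact rscaleDl A : {morph rscale^~ A : s t / s + t}.
Proof. by move=> s t; apply/matrixP => i j; rewrite !mxE rmorphD scalerDl. Qed.

HB.instance Definition _ := GRing.Zmodule_isLmodule.Build R rmodmx
  rscaleA rscale1 rscaleDr rscaleDl.

End RealScalars.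

Section Congruence.
Local Open Scope complex_scope.
Variable R : realType.
Local Notation C := R[i].
Local Notation Re := (@complex.Re R).
Local Notation Im := (@complex.Im R).
Local Notation "A ^H" := (adjmx A) (at level 8, format "A ^H").

Section Module.
Variable W : lmodType C.

Lemma mxcong0 n k (X : 'M[C]_(n, k)) : mxcong X (0 : 'M[W]_n) = 0.
Proof.
by apply/matrixP => i j; rewrite !mxE; do 2!(apply: big1 => ? _);
  rewrite mxE scaler0.
Qed.

Lemma mxcong_rscale n k (X : 'M[C]_(n, k)) (t : R) (A : 'M[W]_n) :
  mxcong X (map_mx (fun a => t%:C *: a) A) =
  map_mx (fun a => t%:C *: a) (mxcong X A).
Proof.
apply/matrixP => i j; rewrite !mxE scaler_sumr; apply: eq_bigr => p _.
rewrite scaler_sumr; apply: eq_bigr => q _.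
by rewrite mxE !scalerA mulrC.
Qed.

Lemma mxcong_scalel n k (X : 'M[C]_(n, k)) (t : R) (A : 'M[W]_n) :
  mxcong (t%:C *: X) A = map_mx (fun a => (t ^+ 2)%:C *: a) (mxcong X A).
Proof.
apply/matrixP => i j; rewrite !mxE scaler_sumr; apply: eq_bigr => p _.
rewrite scaler_sumr; apply: eq_bigr => q _; rewrite !mxE scalerA; congr (_ *: _).
by rewrite rmorphM /= conj_real rmorphXn /= expr2 mulrACA.
Qed.

Lemma mxcong_scalar n (t : R) (A : 'M[W]_n) :
  mxcong (t%:C%:M) A = map_mx (fun a => (t ^+ 2)%:C *: a) A.
Proof.
apply/matrixP => i j; rewrite !mxE (bigD1 i) //= (bigD1 j) //=.
rewrite !mxE !eqxx !mulr1n conj_real -rmorphM /= big1 => [|q /negPf qj].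
  rewrite big1 ?addr0 // => p /negPf pi; apply: big1 => q _.
  by rewrite !mxE pi mulr0n rmorph0 mul0r scale0r.
by rewrite !mxE qj mulr0n mulr0 scale0r.
Qed.

Lemma mxcong_col_mx m n k (X : 'M[C]_(m, k)) (Y : 'M[C]_(n, k))
    (A : 'M[W]_m) (B : 'M[W]_n) :
  mxcong (col_mx X Y) (block_mx A 0 0 B) = mxcong X A + mxcong Y B.
Proof.
apply/matrixP => i j; rewrite !mxE big_split_ord /=; congr (_ + _).
  apply: eq_bigr => p _; rewrite big_split_ord /= [X in _ + X]big1 ?addr0.
    by apply: eq_bigr => q _; rewrite block_mxEul !col_mxEu.
  by move=> q _; rewrite block_mxEur [X in _ *: X]mxE scaler0.
apply: eq_bigr => p _; rewrite big_split_ord /= [X in X + _]big1 ?add0r.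
  by apply: eq_bigr => q _; rewrite block_mxEdr !col_mxEd.
by move=> q _; rewrite block_mxEdl [X in _ *: X]mxE scaler0.
Qed.

(* Action of the amplification of [psi] on [n]-tuples of row vectors. *)
Definition act k (psi : W -> 'M[C]_k) n (z : 'M[W]_n) (X : 'M[C]_(n, k)) :
    'M[C]_(n, k) :=
  \matrix_(p, b) \sum_q \sum_a X q a * psi (z p q) a b.

Lemma act_linear k (psi : W -> 'M[C]_k) n (z : 'M[W]_n) : linear (act psi z).
Proof.
move=> a X Y; apply/matrixP => p b; rewrite !mxE mulr_sumr -big_split.
apply: eq_bigr => q _; rewrite /= mulr_sumr -big_split; apply: eq_bigr => c _.
by rewrite !mxE mulrDl mulrA.
Qed.

Lemma row_act k (psi : W -> 'M[C]_k) n (z : 'M[W]_n) X p :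
  row p (act psi z X) = \sum_q row q X *m psi (z p q).
Proof.
apply/rowP => b; rewrite !mxE summxE; apply: eq_bigr => q _.
by rewrite mxE; apply: eq_bigr => a _; rewrite mxE.
Qed.

Lemma act_conj k (psi : W -> 'M[C]_k) l (T : 'M[C]_(l, k)) (V : 'M[C]_(k, l)) n
    (z : 'M[W]_n) (X : 'M[C]_(n, l)) :
  act (fun w => T *m psi w *m V) z X = act psi z (X *m T) *m V.
Proof.
apply/row_matrixP => p; rewrite row_mul !row_act mulmx_suml.
by apply: eq_bigr => q _; rewrite row_mul !mulmxA.
Qed.

Definition emx n (b a : 'I_n) (w : W) : 'M[W]_n :=
  \matrix_(i, j) if (i == b) && (j == a) then w else 0.

Lemma emxD n (b a : 'I_n) w w' : emx b a (w + w') = emx b a w + emx b a w'.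
Proof. by apply/matrixP => i j; rewrite !mxE; case: ifP; rewrite ?addr0. Qed.

Lemma emx_rscale n (b a : 'I_n) t w :
  emx b a (t%:C *: w) = map_mx (fun a => t%:C *: a) (emx b a w).
Proof. by apply/matrixP => i j; rewrite !mxE; case: ifP; rewrite ?scaler0. Qed.

(** The order of summation and the coefficients are those of the expansion of
    [frob (act psi A X) X], which allows a comparison term by term. *)
Lemma mxcong_emx n k (X : 'M[C]_(k, n)) (A : 'M[W]_k) :
  mxcong X A = \sum_p \sum_b \sum_q \sum_a
    emx b a ((X q a * Num.conj (X p b)) *: A p q).
Proof.
apply/matrixP => i j; rewrite !mxE summxE; apply: eq_bigr => p _.
rewrite summxE (bigD1 i) //= [X in _ + X]big1 ?addr0 => [|b /negPf bi].
  rewrite summxE; apply: eq_bigr => q _.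
  rewrite summxE (bigD1 j) //= [X in _ + X]big1 ?addr0 => [|a /negPf aj].
    by rewrite !mxE !eqxx mulrC.
  by rewrite mxE [j == a]eq_sym aj andbF.
rewrite summxE big1 // => q _; rewrite summxE big1 // => a _.
by rewrite mxE [i == b]eq_sym bi.
Qed.

Section Complexification.
Variables (n : nat) (g : 'M[W]_n -> R).
Hypothesis gD : forall A B, g (A + B) = g A + g B.
Hypothesis gZ : forall (t : R) A, g (map_mx (fun a => t%:C *: a) A) = t * g A.

(* The matrix-valued complex-linear map whose amplifications have [g] as the real
   part of their quadratic forms. *)
Definition cplx (w : W) : 'M[C]_n :=
  \matrix_(a, b) Complex (g (emx b a w)) (- g (emx b a ('i%C *: w))).

(** The usual recovery of a complex functional from its real part, [g w - i g (i w)]. The indices of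
    [emx] are transposed because [cplx w] acts on rows from the right. *)
Lemma Re_cplx c w a b : Re (c * cplx w a b) = g (emx b a (c *: w)).
Proof.
rewrite cReM !mxE /= mulrN opprK; case: c => x y /=.
rewrite -!gZ -gD; congr g; rewrite -!emx_rscale -emxD; congr emx.
rewrite scalerA -scalerDl; congr (_ *: _).
by apply: complex_eqP; rewrite ?cReD ?cImD ?cReM ?cImM /=; ring.
Qed.

Lemma cplx_linear : linear cplx.
Proof.
move=> c w w'; apply/matrixP => a b; rewrite [RHS]mxE [X in _ = X + _]mxE.
have Re_c u : Re (cplx u a b) = g (emx b a u).
  by rewrite -[X in Re X]mul1r Re_cplx scale1r.
have Im_c u : Im (cplx u a b) = - g (emx b a ('i%C *: u)) by rewrite mxE.
apply: complex_eqP.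
  by rewrite cReD Re_cplx !Re_c emxD gD.
rewrite cImD !Im_c scalerDr emxD gD scalerA -Re_cplx opprD; congr (_ - _).
by rewrite -mulrA cReM /= mul0r mul1r sub0r opprK.
Qed.

(** This is the bridge between functionals and maps: bounds for [g] on congruences are bounds for
    the real forms of all amplifications of [cplx g]. *)
Lemma Re_frob_act k (X : 'M[C]_(k, n)) (A : 'M[W]_k) :
  Re (frob (act cplx A X) X) = g (mxcong X A).
Proof.
have g0 : g 0 = 0 by have := gD 0 0; rewrite addr0; lra.
have g_sum (I : finType) (F : I -> 'M[W]_n) : g (\sum_i F i) = \sum_i g (F i).
  exact: (big_morph g gD g0).
rewrite frobE cRe_sum mxcong_emx g_sum; apply: eq_bigr => p _.
rewrite cRe_sum g_sum; apply: eq_bigr => b _.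
rewrite mxE mulr_suml cRe_sum g_sum; apply: eq_bigr => q _.
rewrite mulr_suml cRe_sum g_sum; apply: eq_bigr => a _.
by rewrite -Re_cplx mulrAC.
Qed.

End Complexification.
End Module.

Lemma vnormE k (v : 'cV[C]_k) : vnorm v = Num.sqrt (nsq v).
Proof.
rewrite /vnorm nsqE; congr Num.sqrt; apply: eq_bigr => i _.
rewrite big_ord1 /cabs normc_def /= sqr_sqrtr // addr_ge0 ?sqr_ge0 //.
Qed.

Lemma smxnorm_le n k (X : 'M[C]_(n, k)) (t : R) : 0 <= t ->
  (forall v : 'cV[C]_k, nsq (X *m v) <= t * nsq v) -> smxnorm X ^+ 2 <= t.
Proof.
move=> t0 Xt.
have ub u : [set vnorm (X *m v) | v in [set v : 'cV[C]_k | vnorm v <= 1]]%classic u ->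
    u <= Num.sqrt t.
  move=> [v /=]; rewrite !vnormE => v1 <-; rewrite ler_sqrt //.
  apply: le_trans (Xt v) _; rewrite -[leRHS]mulr1 ler_wpM2l //.
  by rewrite -ler_sqrt ?ler01 // sqrtr1.
have mem0 : [set vnorm (X *m v) | v in [set v : 'cV[C]_k | vnorm v <= 1]]%classic 0.
  by exists 0; rewrite /= ?mulmx0 vnormE nsq0 sqrtr0 ?ler01.
have s0 : 0 <= smxnorm X by apply: ub_le_sup => //; exists (Num.sqrt t) => u /ub.
have sX : smxnorm X <= Num.sqrt t by apply: ge_sup; [exists 0 | move=> u /ub].
by rewrite -(sqr_sqrtr t0) lerXn2r // nnegrE ?sqrtr_ge0.
Qed.

Lemma frob_adjmx m n (X Y : 'M[C]_(m, n)) : frob X^H Y^H = frob Y X.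
Proof. by rewrite /frob adjmxK mxtrace_mulC. Qed.

Lemma frob_mulmxr m n k (A : 'M[C]_(m, n)) (X : 'M[C]_(n, k)) Y :
  frob (A *m X) Y = frob X (A^H *m Y).
Proof.
by rewrite -frob_adjmx adjmx_mul frob_conj frob_mulmxl -frob_conj -adjmx_mul frob_adjmx.
Qed.

End Congruence.

(** * Separating maps into matrices *)

Section Separation.
Local Open Scope complex_scope.
Variables (R : realType) (Z : lmodType R[i]) (nu : forall n : nat, 'M[Z]_n -> R).
Hypothesis nu_gauge : matrix_gauge nu.
Local Notation C := R[i].
Local Notation Re := (@complex.Re R).
Local Notation Im := (@complex.Im R).
Local Notation "A ^H" := (adjmx A) (at level 8, format "A ^H").

Lemma nu_ge0 n (A : 'M[Z]_n) : 0 <= nu A.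
Proof. by case: nu_gauge => -[]. Qed.

Lemma nuZ n (t : R) (A : 'M[Z]_n) : 0 <= t ->
  nu (map_mx (fun a => t%:C *: a) A) = t * nu A.
Proof. by case: nu_gauge => _ /(_ n)[_ _]; apply. Qed.

Lemma nu0 n : nu (0 : 'M[Z]_n) = 0.
Proof.
have := nuZ (0 : 'M[Z]_n) (lexx 0); rewrite mul0r => <-; congr nu.
by apply/matrixP => i j; rewrite !mxE scaler0.
Qed.

Lemma nu_mxcong n k (A : 'M[Z]_n) (X : 'M[C]_(n, k)) :
  nu (mxcong X A) <= smxnorm X ^+ 2 * nu A.
Proof. by case: nu_gauge => -[_ + _] _; apply. Qed.

Lemma nu_block n m (A : 'M[Z]_n) (B : 'M[Z]_m) :
  nu (block_mx A 0 0 B) = Num.max (nu A) (nu B).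
Proof. by case: nu_gauge => -[_ _ +] _; apply. Qed.

(** Admissibility, as an inequality of forms; the rows of [X] are the components of a vector of the
    [n]-fold sum. *)
Definition contractive k (psi : Z -> 'M[C]_k) :=
  forall n (z : 'M[Z]_n) X, Re (frob (act psi z X) X) <= nu z * nsq X.

(** * The cone [K] and its sublinear functional *)

Section Cone.
Variable n : nat.

(** The cone [K]. The relation [X^H X <= h] is tested on real parts of forms, so [h] ranges over all
    matrices and only its Hermitian part matters. *)
Definition gcone (w : 'M[Z]_n) (h : 'M[C]_n) : Prop :=
  exists k (w' : 'M[Z]_k) (X : 'M[C]_(k, n)),
    [/\ nu w' <= 1, w = mxcong X w' &
        forall v : 'cV[C]_n, nsq (X *m v) <= Re (frob (h *m v) v)].

(** Sums are realised by direct sums: stacking [X1] over [X2] adds both the congruences and the Gram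
    matrices, while the gauge of the block matrix is only the maximum. *)
Lemma gconeD w1 h1 w2 h2 :
  gcone w1 h1 -> gcone w2 h2 -> gcone (w1 + w2) (h1 + h2).
Proof.
move=> [k1 [u1 [X1 [nu1 -> h1X]]]] [k2 [u2 [X2 [nu2 -> h2X]]]].
exists (k1 + k2)%N, (block_mx u1 0 0 u2), (col_mx X1 X2); split.
- by rewrite nu_block ge_max nu1.
- by rewrite mxcong_col_mx.
- move=> v; rewrite mul_col_mx /nsq frob_col_mx mulmxDl frobDl !cReD.
  by rewrite lerD ?h1X ?h2X.
Qed.

Lemma gconeZ (t : R) w h : 0 < t -> gcone w h ->
  gcone (map_mx (fun a => t%:C *: a) w) (t%:C *: h).
Proof.
move=> t0 [k [u [X [u1 -> hX]]]]; exists k, u, ((Num.sqrt t)%:C *: X).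
rewrite mxcong_scalel (sqr_sqrtr (ltW t0)); split=> // v.
by rewrite -!scalemxAl nsqZ (sqr_sqrtr (ltW t0)) frobZl cReZ ler_pM2l.
Qed.

Lemma gcone_mxcong k (w : 'M[Z]_k) (X : 'M[C]_(k, n)) :
  nu w <= 1 -> gcone (mxcong X w) (X^H *m X).
Proof.
move=> w1; exists k, w, X; split=> // v.
by rewrite -mulmxA frob_mulmxr adjmxK lexx.
Qed.

Lemma nsq_scalar_mul (t : R) (v : 'cV[C]_n) : Re (frob (t%:C%:M *m v) v) = t * nsq v.
Proof. by rewrite mul_scalar_mx frobZl cReZ. Qed.

Lemma gcone_scalar (t : R) w : 0 < t -> nu w <= t -> gcone w t%:C%:M.
Proof.
move=> t0 wt; exists n, (map_mx (fun a => (t^-1)%:C *: a) w), (Num.sqrt t)%:C%:M.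
split=> [||v].
- by rewrite nuZ ?invr_ge0 ?(ltW t0) // ler_pdivrMl // mulr1.
- rewrite mxcong_scalar (sqr_sqrtr (ltW t0)); apply/matrixP => i j.
  by rewrite !mxE scalerA -rmorphM divff ?gt_eqF // scale1r.
- by rewrite mul_scalar_mx nsqZ (sqr_sqrtr (ltW t0)) nsq_scalar_mul.
Qed.

Lemma gcone0 h : (forall v : 'cV[C]_n, 0 <= Re (frob (h *m v) v)) -> gcone 0 h.
Proof.
move=> h0; exists n, 0, 0; rewrite nu0 mxcong0; split=> // v.
by rewrite mul0mx nsq0.
Qed.

(** A crude entrywise bound suffices; the lemma ensures that every [h] enters the cone after adding
    a large scalar. *)
Lemma form_lower_bound (h : 'M[C]_n) :
  exists2 t : R, 0 <= t &
    forall v : 'cV[C]_n, 0 <= Re (frob ((h + t%:C%:M) *m v) v).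
Proof.
pose r i j := `|Re (h i j)| + `|Im (h i j)|.
exists (\sum_i \sum_j r i j) => [|v].
  by do 2!(apply: sumr_ge0 => ? _); rewrite addr_ge0.
rewrite mulmxDl frobDl cReD nsq_scalar_mul -lerBlDr sub0r lerNl.
have entry i j : - Re (h i j * v j 0 * Num.conj (v i 0)) <= r i j * nsq v.
  have := nsq_entry_le v i 0; have := nsq_entry_le v j 0; rewrite /r.
  rewrite -mulrA; move: (h i j) (v i 0) (v j 0) (nsq v).
  move=> [a b] [c d] [e f] s; rewrite !(cReM, cImM, cRe_conj, cIm_conj) /= => *.
  (* These squares bound the real and imaginary parts of [v j * conj (v i)] by the average of the
     two squared moduli, hence by [nsq v]. *)
  have := (sqr_ge0 (e - c), sqr_ge0 (e + c), sqr_ge0 (f - d), sqr_ge0 (f + d)).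
  move=> [[[q1 q2] q3] q4].
  have := (sqr_ge0 (e - d), sqr_ge0 (e + d), sqr_ge0 (f - c), sqr_ge0 (f + c)).
  move=> [[[q5 q6] q7] q8].
  have s1 : `|e * c - f * - d| <= s by rewrite ler_norml; apply/andP; split; lra.
  have s2 : `|e * - d + f * c| <= s by rewrite ler_norml; apply/andP; split; lra.
  have := ler_wpM2l (normr_ge0 a) s1; have := ler_wpM2l (normr_ge0 b) s2.
  rewrite -!normrM mulrDl.
  have := ler_norm (- (a * (e * c - f * - d))); rewrite normrN.
  have := ler_norm (b * (e * - d + f * c)); lra.
rewrite frobE cRe_sum -sumrN mulr_suml; apply: ler_sum => i _.
rewrite big_ord1 !mxE mulr_suml cRe_sum -sumrN mulr_suml.
by apply: ler_sum => j _.
Qed.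

Lemma scale_reg (t : R) (h : 'M[C]_n) :
  t *: (h : rmodmx C^o n) = (t%:C *: h : 'M[C]_n).
Proof. by apply/matrixP => i j; rewrite !mxE. Qed.

Local Notation E := (rmodmx Z n * rmodmx C^o n)%type.

Definition gap (x : E) : set R := [set t | gcone x.1 ((x.2 : 'M[C]_n) + t%:C%:M)]%classic.

(** The functional [Q]; [gap_lb] and [gap_neq0] make the infimum meaningful. *)
Definition gapinf (x : E) : R := inf (gap x).

Hypothesis n_gt0 : (0 < n)%N.

Lemma unit_vector : exists v : 'cV[C]_n, nsq v = 1.
Proof.
exists (delta_mx (Ordinal n_gt0) 0).
rewrite nsqE (bigD1 (Ordinal n_gt0)) //= [X in _ + X]big1 => [|i /negPf ni].
  by rewrite big_ord1 !mxE !eqxx /= expr1n expr0n /= !addr0.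
by rewrite big_ord1 !mxE ni /= expr0n addr0.
Qed.

(** Evaluating the defining inequality at one unit vector bounds [t] below. For [n = 0] there is
    none, and the gap is the whole line. *)
Lemma gap_lb (x : E) : exists b, forall t, gap x t -> b <= t.
Proof.
have [v v1] := unit_vector.
exists (- Re (frob ((x.2 : 'M[C]_n) *m v) v)) => t [k [w [X [_ _ /(_ v)]]]].
rewrite mulmxDl frobDl cReD nsq_scalar_mul v1.
by have := nsq_ge0 (X *m v); move: (nsq _) (Re _) => *; lra.
Qed.

Lemma gap_neq0 (x : E) : exists t, gap x t.
Proof.
have [t t0 ht] := form_lower_bound (x.2 : 'M[C]_n).
(* The scalar [t] makes the second component nonnegative and the rest dominates the first; the added
   [1] keeps that scalar positive when the gauge vanishes. *)
exists (t + (nu (x.1 : 'M[Z]_n) + 1)); rewrite /gap /=.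
rewrite rmorphD raddfD addrA -[x.1]add0r; apply: gconeD; first exact: gcone0.
apply: gcone_scalar; first exact: ltr_wpDl (nu_ge0 _) ltr01. by rewrite add0r lerDl.
Qed.

Lemma gapinf_le (x : E) t : gap x t -> gapinf x <= t.
Proof. by have [b lb] := gap_lb x; exact: inf_le_mem lb. Qed.

Lemma gapinf_sublinear : sublinear gapinf.
Proof.
split=> [x y|t x t0].
  apply/ler_addgt0Pr => e e0.
  have e20 : 0 < e / 2 by rewrite divr_gt0.
  have [b lb] := gap_lb x; have [c lc] := gap_lb y.
  have [t gt xt] := inf_approx (gap_neq0 x) lb e20.
  have [s gs ys] := inf_approx (gap_neq0 y) lc e20.
  have : gapinf (x + y) <= t + s.
    apply: gapinf_le; case: x y gt gs {xt ys lb lc} => [w h] [w' h'] gt gs.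
    have := gconeD gt gs; rewrite /gap /=.
    by rewrite rmorphD raddfD addrACA.
  have {}xt : t < gapinf x + e / 2 := xt.
  have {}ys : s < gapinf y + e / 2 := ys.
  by move: (gapinf _) (gapinf _) (gapinf _) xt ys => *; lra.
rewrite -ler_pdivrMl //; apply/ler_addgt0Pr => e e0.
have [b lb] := gap_lb x.
have [s gs xs] := inf_approx (gap_neq0 x) lb e0.
apply: le_trans (ltW xs); rewrite ler_pdivrMl //; apply: gapinf_le.
case: x {lb xs} gs => [w h] gs; have := gconeZ t0 gs; rewrite /gap /=.
by rewrite scalerDr scale_scalar_mx -rmorphM scale_reg.
Qed.

(** If [(z, t 1)] lies in [K], then [z = X^H w X] with [nu w <= 1] and [X^H X <= t], so matrix
    compatibility gives [nu z <= t]. *)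
Lemma nu_le_gapinf (z : 'M[Z]_n) : nu z <= gapinf (z, 0).
Proof.
apply/ler_addgt0Pr => e e0; have [b lb] := gap_lb (z, 0).
have [t /= gt zt] := inf_approx (gap_neq0 (z, 0)) lb e0.
apply: le_trans (ltW zt); case: gt => k [w [X [w1 /= -> hX]]].
have {}hX (v : 'cV_n) : nsq (X *m v) <= t * nsq v.
  by have := hX v; rewrite add0r nsq_scalar_mul.
have t0 : 0 <= t.
  by have [v v1] := unit_vector; have := hX v; rewrite v1 mulr1; apply: le_trans (nsq_ge0 _).
apply: le_trans (nu_mxcong _ _) _; rewrite -[leRHS]mulr1.
by apply: ler_pM => //; [exact: sqr_ge0 | exact: nu_ge0 | exact: smxnorm_le].
Qed.

(** Allows normalisation by some [c > u] when [u] itself may be zero. *)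
Lemma le_mul_of_forall_gt (a u b : R) : 0 <= b ->
  (forall c, u < c -> a <= c * b) -> a <= u * b.
Proof.
move=> b0 abc; apply/ler_addgt0Pr => e e0.
have b1 : 0 < b + 1 by lra.
have := abc (u + e / (b + 1)); rewrite ltrDl divr_gt0 // => /(_ isT) h.
apply: le_trans h _; rewrite mulrDl lerD2l mulrAC ler_pdivrMr //.
by rewrite ler_pM2l //; lra.
Qed.

Definition real_linear (W : lmodType C) (g : 'M[W]_n -> R) : Prop :=
  (forall A B, g (A + B) = g A + g B) /\
  (forall (t : R) A, g (map_mx (fun a => t%:C *: a) A) = t * g A).

Lemma dominated_functional (z : 'M[Z]_n) :
  exists (f : 'M[Z]_n -> R) (p : 'M[C^o]_n -> R),
  [/\ real_linear f, real_linear p,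
      forall k (w : 'M[Z]_k) (X : 'M[C]_(k, n)),
        0 <= p (X^H *m X) /\ f (mxcong X w) <= nu w * p (X^H *m X),
      p 1%:M = 1 & nu z <= f z].
Proof.
have [L [LD LZ Lle Lz]] := @hahn_banach _ E _ (z, 0) gapinf_sublinear.
have L_gcone w h t : gcone w (h + t%:C%:M) -> L (w, h) <= t.
  by move=> wh; apply: le_trans (Lle _) _; exact: gapinf_le.
(* On [K] one has [L <= 0], that is [f w <= p h]. Elements [(X^H w X, X^H X)] give the domination,
   and [w = 0] gives positivity of [p]. *)
pose f (A : 'M[Z]_n) := L (A, 0); pose p (h : 'M[C^o]_n) := - L (0, h).
have fpE A h : L (A, h) = f A - p h.
  by rewrite /f /p opprK -LD; congr L; congr pair; rewrite ?addr0 ?add0r.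
have fZ (t : R) A : f (map_mx (fun a => t%:C *: a) A) = t * f A.
  by rewrite /f -LZ; congr L; congr pair; rewrite scaler0.
have pZ (t : R) A : p (map_mx (fun a => t%:C *: a) A) = t * p A.
  by rewrite /p mulrN -LZ; congr (- L _); congr pair; rewrite scaler0.
have f0 : f 0 = 0 by have := LD (0, 0) (0, 0); rewrite /f addr0; lra.
have fp k (w : 'M[Z]_k) X : nu w <= 1 -> f (mxcong X w) <= p (X^H *m X).
  move=> w1; rewrite -subr_le0 -fpE; apply: L_gcone.
  have -> : (0 : R)%:C%:M = 0 :> 'M[C]_n by apply/matrixP => i j; rewrite !mxE mul0rn.
  by rewrite addr0; exact: gcone_mxcong.
have p_ge0 k (X : 'M[C]_(k, n)) : 0 <= p (X^H *m X).
  by rewrite -f0 -(mxcong0 _ X); apply: fp; rewrite nu0.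
exists f, p; split.
- split => // A B; rewrite /f -LD; congr L; congr pair; exact/esym/addr0.
- split => // A B; rewrite /p -opprD -LD; congr (- L _); congr pair.
  exact/esym/addr0.
- move=> k w X; split=> //; apply: le_mul_of_forall_gt => // c wc.
  have c0 : 0 < c by apply: le_lt_trans wc; exact: nu_ge0.
  have := @fp k (map_mx (fun a => (c^-1)%:C *: a) w) X.
  rewrite (nuZ _ (ltW _)) ?invr_gt0 // mxcong_rscale fZ !ler_pdivrMl // mulr1.
  by apply; exact: ltW.
(* Both [(0, 1)] shifted by [-1] and [(0, -1)] shifted by [1] are the vertex of [K], so
   [L (0, 1) = -1]. *)
- apply/eqP; rewrite eq_le; apply/andP; split; last first.
    rewrite /p lerNr; apply: L_gcone; apply: gcone0 => v.
    by rewrite rmorphN raddfN /= subrr mul0mx frob0l.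
  rewrite -[leLHS]opprK /p opprK -[- L _]mulN1r -LZ.
  apply: L_gcone; rewrite /= scaler0; apply: gcone0 => v.
  by rewrite scale_reg rmorphN1 scaleN1r addNr mul0mx frob0l.
- by rewrite /f Lz; exact: nu_le_gapinf.
Qed.

End Cone.
End Separation.

(** * From a dominated functional to an admissible map *)

Section SeparatingMap.
Local Open Scope complex_scope.
Variables (R : realType) (Z : lmodType R[i]) (nu : forall n : nat, 'M[Z]_n -> R).
Hypothesis nu_gauge : matrix_gauge nu.
Local Notation C := R[i].
Local Notation Re := (@complex.Re R).
Local Notation Im := (@complex.Im R).
Local Notation "A ^H" := (adjmx A) (at level 8, format "A ^H").

Lemma act_scalar k (psi : C^o -> 'M[C]_k) n (X : 'M[C]_(n, k)) : psi 0 = 0 ->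
  act psi (1%:M : 'M[C]_n) X = X *m psi 1.
Proof.
move=> psi0; apply/matrixP => p b; rewrite !mxE (bigD1 p) //=.
rewrite [X in _ + X]big1 ?addr0 => [|q /negPf qp].
  by apply: eq_bigr => a _; rewrite mxE eqxx.
by rewrite big1 // => a _; rewrite !mxE eq_sym qp psi0 mxE mulr0.
Qed.

Lemma mxcong_reg n k (X : 'M[C]_(k, n)) :
  mxcong X (1%:M : 'M[C^o]_k) = X^H *m X.
Proof.
apply/matrixP => i j; rewrite !mxE; apply: eq_bigr => p _.
rewrite (bigD1 p) //= [X in _ + X]big1 ?addr0 => [|q /negPf qp].
  by rewrite !mxE eqxx mulr1n /GRing.scale /= mulr1.
by rewrite !mxE eq_sym qp mulr0n scaler0.
Qed.

Lemma nsq1 n : nsq (1%:M : 'M[C]_n) = n%:R.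
Proof.
rewrite nsqE; transitivity (\sum_(i < n) (1 : R)); last by rewrite sumr_const card_ord.
apply: eq_bigr => i _; rewrite (bigD1 i) //= big1 => [|j /negPf ij].
  by rewrite mxE eqxx /= expr1n expr0n /= !addr0.
by rewrite mxE eq_sym ij /= expr0n addr0.
Qed.

(** The excess [e * n] in [nsq Y] is the price of perturbing the state [p] to a definite form. *)
Lemma separating_map n (z : 'M[Z]_n) (e : R) : (0 < n)%N -> 0 < e ->
  exists psi : Z -> 'M[C]_n,
    [/\ linear psi, contractive nu psi &
        exists Y : 'M[C]_n,
          nu z <= Re (frob (act psi z Y) Y) /\ nsq Y = 1 + e * n%:R].
Proof.
move=> n0 e0.
have [f [p [[fD fZ] [pD pZ] fp p1 zf]]] := dominated_functional nu_gauge n0 z.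
have linp := cplx_linear pD pZ.
have p0 : cplx p 0 = 0 by have := linp (-1) 0 0; rewrite scaler0 addr0 scaleN1r addNr.
(* The Gram matrix of the form given by [p] is the complexification of [p], over the regular module,
   evaluated at [1]. *)
have [G0 formG0] : exists G0 : 'M[C]_n, forall k (X : 'M[C]_(k, n)),
    Re (frob (X *m G0) X) = p (X^H *m X).
  by exists (cplx p 1) => k X; rewrite -mxcong_reg -Re_frob_act // act_scalar.
(* Only the Hermitian part of [G0] matters for the real form; the shift by [e]
   makes it invertible. *)
pose G := (2^-1)%:C *: (G0 + G0^H) + e%:C%:M.
have formG k (X : 'M[C]_(k, n)) :
    Re (frob (X *m G) X) = p (X^H *m X) + e * nsq X.
  have adj_form : Re (frob (X *m G0^H) X) = Re (frob (X *m G0) X).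
    by rewrite frob_mulmxl adjmxK frob_conj cRe_conj.
  rewrite mulmxDr frobDl cReD mul_mx_scalar frobZl cReZ; congr (_ + _).
  rewrite -scalemxAr frobZl cReZ mulmxDr frobDl cReD -formG0.
  by rewrite adj_form; move: (Re _) => r; lra.
have GH : G^H = G.
  apply/matrixP => i j; rewrite /G !mxE rmorphD rmorphM rmorphD /= conjCK.
  rewrite conj_real [Num.conj (G0 j i) + _]addrC; congr (_ + _).
  by rewrite eq_sym; case: eqP => _; rewrite ?mulr1n ?mulr0n ?conj_real ?rmorph0.
have [|S [T [ST TS SG]]] := hermitian_factor GH e0.
  by move=> v; rewrite formG lerDr; have [] := fp 1%N 0 v.
have frobT (w : nat) (A : 'M[Z]_w) (Y : 'M[C]_(w, n)) :
    frob (act (fun u => T *m cplx f u *m T^H) A Y) Y =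
    frob (act (cplx f) A (Y *m T)) (Y *m T).
  by rewrite act_conj frob_mulmxl adjmxK.
have nsqS k (X : 'M[C]_(k, n)) : nsq (X *m S) = Re (frob (X *m G) X).
  by rewrite -SG mulmxA frob_mulmxl adjmxK.
(* In the basis orthonormal for [G] the form at [Y] is [f] of the congruence by [Y *m T], and [p] of
   the Gram matrix of [Y *m T] is at most [nsq Y]. *)
exists (fun u => T *m cplx f u *m T^H); split.
- move=> a u v; rewrite (cplx_linear fD fZ) mulmxDr -scalemxAr mulmxDl.
  by rewrite -scalemxAl.
- move=> k w Y; rewrite frobT Re_frob_act //.
  have [h1 h2] := fp k w (Y *m T).
  apply: le_trans h2 _; rewrite ler_wpM2l ?(nu_ge0 nu_gauge) //.
  have -> : nsq Y = nsq (Y *m T *m S) by rewrite -mulmxA TS mulmx1.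
  by rewrite nsqS formG lerDl mulr_ge0 ?nsq_ge0 ?ltW.
(* At [Y = S] the congruence is by [S *m T = 1], which leaves [f z]; and [nsq S] is the form of [G]
   at the identity, [p 1 + e * n]. *)
- exists S; rewrite frobT ST Re_frob_act //; split.
    have -> // : mxcong 1%:M z = z.
    rewrite -[1%:M]/((1 : R)%:C%:M) mxcong_scalar.
    by apply/matrixP => i j; rewrite mxE expr1n scale1r.
  rewrite -[S]mul1mx nsqS formG nsq1; congr (_ + _).
  rewrite -p1; congr p; rewrite mulmx1.
  by apply/matrixP => i j; rewrite !mxE eq_sym rmorph_nat.
Qed.

End SeparatingMap.

(** * Direct sums of finite-dimensional Hilbert spaces *)

Section UnorderedSums.
Local Open Scope fset_scope.
Local Open Scope ring_scope.
Variables (R : realType) (I : choiceType).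
Implicit Types (f g : I -> R) (A B : {fset I}).

Definition psum f A : R := \sum_(i <- A) f i.

(** Convergence along finite subsets, since the index set of all admissible maps carries no
    enumeration. *)
Definition hassum f (l : R) :=
  forall e : R, 0 < e -> exists A0 : {fset I}, forall A, A0 `<=` A -> `|psum f A - l| <= e.

Definition summable f := exists M : R, forall A, psum (fun i => `|f i|) A <= M.

(** The default value is [0] when no sum exists. *)
Definition rsum f : R := xget 0 [set l | hassum f l]%classic.

Lemma psum_le f g A : (forall i, f i <= g i) -> psum f A <= psum g A.
Proof. by move=> fg; apply: ler_sum => i _; exact: fg. Qed.

Lemma psum_ge0 f A : (forall i, 0 <= f i) -> 0 <= psum f A.
Proof. by move=> f0; apply: sumr_ge0 => i _; exact: f0. Qed.

Lemma psumD f g A : psum (fun i => f i + g i) A = psum f A + psum g A.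
Proof. exact: big_split. Qed.

Lemma psumZ (t : R) f A : psum (fun i => t * f i) A = t * psum f A.
Proof. by rewrite /psum mulr_sumr. Qed.

Lemma psum1 f i : psum f [fset i] = f i.
Proof. by rewrite /psum big_seq_fset1. Qed.

Lemma psum_sub f A B : (forall i, 0 <= f i) -> A `<=` B -> psum f A <= psum f B.
Proof.
move=> f0 /fsubsetP AB; rewrite /psum [leRHS](bigID (mem A)) /=.
have -> : \sum_(i <- B | i \in A) f i = \sum_(i <- A) f i.
  rewrite -[LHS]big_filter; apply: perm_big; apply: uniq_perm.
  - by rewrite filter_uniq // fset_uniq.
  - exact: fset_uniq.
  - by move=> i; rewrite mem_filter; apply: andb_idr => /AB.
by rewrite lerDl; apply: sumr_ge0.
Qed.

Lemma hassum_unique f l l' : hassum f l -> hassum f l' -> l = l'.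
Proof.
move=> fl fl'; apply/eqP; rewrite -subr_eq0 -normr_eq0 eq_le normr_ge0 andbT.
apply/ler_addgt0Pr => e e0; rewrite add0r.
have e20 : 0 < e / 2 by rewrite divr_gt0.
have [A hA] := fl _ e20; have [B hB] := fl' _ e20.
have := hA (A `|` B) (fsubsetUl _ _); have := hB (A `|` B) (fsubsetUr _ _).
move: (psum _ _) => s h1 h2; rewrite (_ : l - l' = (s - l') - (s - l)); last by ring.
by apply: le_trans (ler_normB _ _) _; lra.
Qed.

Lemma rsum_eq f l : hassum f l -> rsum f = l.
Proof.
by move=> fl; apply: xget_unique => // l' fl'; exact: hassum_unique fl' fl.
Qed.

Lemma hassumD f g l m : hassum f l -> hassum g m ->
  hassum (fun i => f i + g i) (l + m).
Proof.
move=> fl gm e e0; have e20 : 0 < e / 2 by rewrite divr_gt0.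
have [A hA] := fl _ e20; have [B hB] := gm _ e20.
exists (A `|` B) => D; rewrite fsubUset => /andP[/hA h1 /hB h2].
rewrite psumD opprD addrACA; apply: le_trans (ler_normD _ _) _; lra.
Qed.

Lemma hassumZ (t : R) f l : hassum f l -> hassum (fun i => t * f i) (t * l).
Proof.
move=> fl e e0; have t1 : 0 < `|t| + 1 := ltr_wpDl (normr_ge0 t) ltr01.
have [A hA] := fl _ (divr_gt0 e0 t1).
exists A => D /hA; rewrite psumZ -mulrBr normrM ler_pdivlMr ?ltr_wpDl // => h.
apply: le_trans h; rewrite mulrC ler_wpM2l // lerDl //.
Qed.

Lemma hassum_nonneg f M : (forall i, 0 <= f i) -> (forall A, psum f A <= M) ->
  exists l, hassum f l.
Proof.
move=> f0 fM; pose S := [set psum f A | A in [set: {fset I}]]%classic.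
have supS : has_sup S.
  split; first by exists (psum f fset0); exists fset0.
  by exists M => _ [A _ <-].
exists (sup S) => e e0.
have [_ [A _ <-] hA] := sup_adherent e0 supS.
exists A => B AB; have AB' := psum_sub f0 AB.
have : psum f B <= sup S by apply: ub_le_sup; [case: supS | exists B].
by rewrite ler_norml => ?; apply/andP; split; lra.
Qed.

Lemma summable_nonneg f M : (forall i, 0 <= f i) -> (forall A, psum f A <= M) ->
  summable f.
Proof.
move=> f0 fM; exists M => A; rewrite [psum _ _](_ : _ = psum f A) //.
by apply: eq_bigr => i _; rewrite ger0_norm.
Qed.

(** Write [f] as the difference of the nonnegative families [f + |f|] and [|f|], whose partial sums
    are bounded. *)
Lemma summable_hassum f : summable f -> hassum f (rsum f).
Proof.
move=> [M fM].
have [l hl] : exists l, hassum (fun i => f i + `|f i|) l.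
  apply: (@hassum_nonneg _ (M + M)) => [i|A].
    by have := lerNnormlW (lexx `|f i|); lra.
  rewrite psumD lerD //; apply: le_trans (fM A); apply: psum_le => i.
  exact: ler_norm.
have [m hm] : exists m, hassum (fun i => `|f i|) m by exact: hassum_nonneg fM.
have h : hassum f (l + -1 * m).
  have := hassumD hl (hassumZ (-1) hm); congr hassum; apply/funext => i; ring.
by rewrite (rsum_eq h).
Qed.

Lemma summable_le f g : (forall i, `|f i| <= g i) -> summable g -> summable f.
Proof.
move=> fg [M gM]; exists M => A; apply: le_trans (gM A); apply: psum_le => i.
by apply: le_trans (fg i) _; exact: ler_norm.
Qed.

Lemma summableD f g : summable f -> summable g -> summable (fun i => f i + g i).
Proof.
move=> [M fM] [N gN]; exists (M + N) => A.
apply: le_trans (lerD (fM A) (gN A)); rewrite -psumD; apply: psum_le => i.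
exact: ler_normD.
Qed.

Lemma summableZ (t : R) f : summable f -> summable (fun i => t * f i).
Proof.
move=> [M fM]; exists (`|t| * M) => A.
rewrite [psum _ _](_ : _ = psum (fun i => `|t| * `|f i|) A).
  by rewrite psumZ ler_wpM2l.
by apply: eq_bigr => i _; rewrite normrM.
Qed.

Lemma summable_sum n (F : 'I_n -> I -> R) : (forall p, summable (F p)) ->
  summable (fun i => \sum_p F p i).
Proof.
elim: n F => [|n IHn] F sF.
  by exists 0 => A; rewrite /psum big1 // => i _; rewrite big_ord0 normr0.
by under eq_fun do rewrite big_ord_recr; apply: summableD => //; exact: IHn.
Qed.

Lemma rsumD f g : summable f -> summable g ->
  rsum (fun i => f i + g i) = rsum f + rsum g.
Proof. by move=> /summable_hassum hf /summable_hassum hg; apply/rsum_eq/hassumD. Qed.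

Lemma rsumZ (t : R) f : summable f -> rsum (fun i => t * f i) = t * rsum f.
Proof. by move=> /summable_hassum hf; apply/rsum_eq/hassumZ. Qed.

Lemma rsum0 : rsum (fun=> 0) = 0.
Proof.
apply: rsum_eq => e e0; exists fset0 => A _.
by rewrite /psum big1 // subr0 normr0 ltW.
Qed.

Lemma psum_le_rsum f A : (forall i, 0 <= f i) -> summable f -> psum f A <= rsum f.
Proof.
move=> f0 /summable_hassum hf; apply/ler_addgt0Pr => e /hf[B hB].
have := hB (A `|` B) (fsubsetUr _ _); rewrite ler_norml.
by have := psum_sub f0 (fsubsetUl A B); move=> ? /andP[? ?]; lra.
Qed.

Lemma rsum_le_bound f M : summable f -> (forall A, psum f A <= M) -> rsum f <= M.
Proof.
move=> /summable_hassum hf fM; apply/ler_addgt0Pr => e /hf[B /(_ B (fsubset_refl _))].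
by rewrite ler_norml => /andP[? _]; have := fM B; lra.
Qed.

Lemma rsum_ge0 f : (forall i, 0 <= f i) -> summable f -> 0 <= rsum f.
Proof.
by move=> f0 sf; have := psum_le_rsum fset0 f0 sf; apply: le_trans; exact: psum_ge0.
Qed.

Lemma le_rsum f g : (forall i, f i <= g i) -> summable f -> summable g ->
  rsum f <= rsum g.
Proof.
move=> fg sf sg; rewrite -subr_ge0 -mulN1r -rsumZ // -rsumD //; last exact: summableZ.
apply: rsum_ge0 => [i|]; first by have := fg i; lra.
by apply: summableD => //; exact: summableZ.
Qed.

Lemma rsum_support1 f i0 : (forall i, i != i0 -> f i = 0) -> rsum f = f i0.
Proof.
move=> fi; apply: rsum_eq => e e0; exists [fset i0] => A; rewrite fsub1set => iA.
rewrite /psum (big_fsetD1 i0) //= big_seq big1 ?addr0 ?subrr ?normr0 ?ltW // => i.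
by rewrite !inE => /andP[/fi].
Qed.

End UnorderedSums.

(** The limit is the supremum of the eventual lower bounds. *)
Lemma real_cauchy_cvg (R : realType) (u : nat -> R) :
  (forall e, 0 < e -> exists N, forall m n, (N <= m)%N -> (N <= n)%N ->
     `|u m - u n| <= e) ->
  exists l, forall e, 0 < e -> exists N, forall n, (N <= n)%N -> `|u n - l| <= e.
Proof.
move=> cu; pose S := [set x | exists N, forall n, (N <= n)%N -> x <= u n]%classic.
have mem_S e N : (forall m n, (N <= m)%N -> (N <= n)%N -> `|u m - u n| <= e) ->
    S (u N - e).
  move=> h; exists N => n Nn; have := h n N Nn (leqnn _).
  by rewrite ler_norml => /andP[]; lra.
have ub_S e N : (forall m n, (N <= m)%N -> (N <= n)%N -> `|u m - u n| <= e) ->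
    forall x, S x -> x <= u N + e.
  move=> h x [M xM]; have := h (maxn M N) N (leq_maxr _ _) (leqnn _).
  by rewrite ler_norml => /andP[]; have := xM _ (leq_maxl M N); lra.
exists (sup S) => e e0; have e20 : 0 < e / 2 by rewrite divr_gt0.
have [N h] := cu _ e20; exists N => n Nn.
have lo : u N - e / 2 <= sup S.
  by apply: ub_le_sup; [exists (u N + e / 2); exact: ub_S | exact: mem_S].
have hi : sup S <= u N + e / 2.
  by apply: ge_sup; [exists (u N - e / 2); exact: mem_S | exact: ub_S].
have := h n N Nn (leqnn _); rewrite !ler_norml => /andP[? ?].
by apply/andP; split; lra.
Qed.

Lemma null_sum (R : realType) (J : Type) (s : seq J) (v : J -> nat -> R) :
  (forall j (e : R), 0 < e -> exists N, forall n, (N <= n)%N -> v j n <= e) ->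
  forall e : R, 0 < e -> exists N, forall n, (N <= n)%N -> \sum_(j <- s) v j n <= e.
Proof.
move=> hv; elim: s => [|j s IHs] e e0.
  by exists 0%N => n _; rewrite big_nil ltW.
have e20 : 0 < e / 2 by rewrite divr_gt0.
have [N hN] := hv j _ e20; have [M hM] := IHs _ e20.
exists (maxn N M) => n; rewrite geq_max => /andP[/hN h1 /hM h2].
by rewrite big_cons; lra.
Qed.

(** * The l2-sum as a Hilbert space *)

Section DirectSum.
Local Open Scope complex_scope.
Variable R : realType.
Local Notation C := R[i].
Local Notation Re := (@complex.Re R).
Local Notation Im := (@complex.Im R).

Lemma nsqZc m n (a : C) (X : 'M[C]_(m, n)) :
  nsq (a *: X) = (Re a ^+ 2 + Im a ^+ 2) * nsq X.
Proof.
rewrite /nsq frobZl frobZr frobXX mulrA cReM /= mulr0 subr0.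
by rewrite cReM cRe_conj cIm_conj mulrN opprK !expr2.
Qed.

Variables (I : choiceType) (k : I -> nat).
Local Notation family := (forall i, 'rV[C]_(k i)).

Definition square_summable (x : family) := summable (fun i => nsq (x i)).

Lemma square_summable_le (x y : family) (M : R) :
  (forall i, nsq (x i) <= M * nsq (y i)) -> square_summable y -> square_summable x.
Proof.
move=> xy sy; apply: summable_le (summableZ M sy) => i.
by rewrite ger0_norm ?nsq_ge0.
Qed.

Lemma square_summable0 : square_summable (fun=> 0).
Proof. by exists 0 => A; rewrite /psum big1 // => i _; rewrite nsq0 normr0. Qed.

Lemma square_summableD (x y : family) : square_summable x -> square_summable y ->
  square_summable (fun i => x i + y i).
Proof.
move=> sx sy; apply: summable_le (summableD (summableZ 2 sx) (summableZ 2 sy)) => i.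
by rewrite ger0_norm ?nsq_ge0 // nsqD_le.
Qed.

Lemma square_summableZ (a : C) (x : family) : square_summable x ->
  square_summable (fun i => a *: x i).
Proof. by apply: square_summable_le => i; rewrite nsqZc. Qed.

Record l2sum := L2sum { l2fun :> family; l2P : square_summable l2fun }.

Lemma l2_inj (x y : l2sum) : (forall i, x i = y i) -> x = y.
Proof.
case: x y => x sx [y sy] /= xy.
have {xy} E : x = y by exact: functional_extensionality_dep.
by case: _ / E sy => sy; congr L2sum; exact: Prop_irrelevance.
Qed.

HB.instance Definition _ := gen_eqMixin l2sum.
HB.instance Definition _ := gen_choiceMixin l2sum.

Definition l2zero := L2sum square_summable0.
Definition l2add (x y : l2sum) := L2sum (square_summableD (l2P x) (l2P y)).
Definition l2scale a (x : l2sum) := L2sum (square_summableZ a (l2P x)).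
Definition l2opp (x : l2sum) := l2scale (-1) x.

Fact l2addA : associative l2add.
Proof. by move=> x y z; apply: l2_inj => i /=; rewrite addrA. Qed.
Fact l2addC : commutative l2add.
Proof. by move=> x y; apply: l2_inj => i /=; rewrite addrC. Qed.
Fact l2add0 : left_id l2zero l2add.
Proof. by move=> x; apply: l2_inj => i /=; rewrite add0r. Qed.
Fact l2addN : left_inverse l2zero l2opp l2add.
Proof. by move=> x; apply: l2_inj => i /=; rewrite scaleN1r addNr. Qed.
HB.instance Definition _ := GRing.isZmodule.Build l2sum l2addA l2addC l2add0 l2addN.

Fact l2scaleA a b x : l2scale a (l2scale b x) = l2scale (a * b) x.
Proof. by apply: l2_inj => i /=; rewrite scalerA. Qed.
Fact l2scale1 : left_id 1 l2scale.
Proof. by move=> x; apply: l2_inj => i /=; rewrite scale1r. Qed.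
Fact l2scaleDr : right_distributive l2scale +%R.
Proof. by move=> a x y; apply: l2_inj => i /=; rewrite scalerDr. Qed.
Fact l2scaleDl x : {morph l2scale^~ x : a b / a + b}.
Proof. by move=> a b; apply: l2_inj => i /=; rewrite scalerDl. Qed.
HB.instance Definition _ := GRing.Zmodule_isLmodule.Build C l2sum
  l2scaleA l2scale1 l2scaleDr l2scaleDl.

Lemma l2funD (x y : l2sum) i : (x + y) i = x i + y i. Proof. by []. Qed.
Lemma l2funZ a (x : l2sum) i : (a *: x) i = a *: x i. Proof. by []. Qed.
Lemma l2funN (x : l2sum) i : (- x) i = - x i.
Proof. by rewrite -scaleN1r l2funZ scaleN1r. Qed.
Lemma l2fun0 i : (0 : l2sum) i = 0. Proof. by []. Qed.
Lemma l2fun_sum n (F : 'I_n -> l2sum) i : (\sum_j F j) i = \sum_j F j i.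
Proof.
by elim/big_rec2: _ => [|j y1 y2 _ <-]; rewrite ?l2fun0 ?l2funD.
Qed.

Definition csum (f : I -> C) : C :=
  Complex (rsum (fun i => Re (f i))) (rsum (fun i => Im (f i))).
Definition csummable (f : I -> C) :=
  summable (fun i => Re (f i)) /\ summable (fun i => Im (f i)).

Lemma csummableD f g : csummable f -> csummable g ->
  csummable (fun i => f i + g i).
Proof.
move=> [f1 f2] [g1 g2]; split.
  by under eq_fun do rewrite cReD; exact: summableD.
by under eq_fun do rewrite cImD; exact: summableD.
Qed.

Lemma csumD f g : csummable f -> csummable g ->
  csum (fun i => f i + g i) = csum f + csum g.
Proof.
move=> [f1 f2] [g1 g2]; apply: complex_eqP; rewrite ?cReD ?cImD /= -rsumD //;
  by congr rsum; apply/funext => i; rewrite ?cReD ?cImD.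
Qed.

Lemma csum_sum n (F : 'I_n -> I -> C) : (forall p, csummable (F p)) ->
  csum (fun i => \sum_p F p i) = \sum_p csum (F p).
Proof.
move=> sF.
suff [] : csummable (fun i => \sum_p F p i) /\
    csum (fun i => \sum_p F p i) = \sum_p csum (F p) by [].
elim: n F sF => [|n IHn] F sF.
  under eq_fun do rewrite big_ord0; rewrite big_ord0; split.
    by split; exists 0 => A; rewrite /psum big1 // => i _; rewrite normr0.
  by rewrite /csum rsum0.
under eq_fun do rewrite big_ord_recr; rewrite big_ord_recr /=.
have [sF' eF'] := IHn (fun p => F (widen_ord (leqnSn n) p)) (fun p => sF _).
by split; [exact: csummableD | rewrite csumD ?eF'].
Qed.

Lemma csumZ a f : csummable f -> csum (fun i => a * f i) = a * csum f.
Proof.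
move=> [f1 f2]; apply: complex_eqP.
  rewrite cReM /= -!rsumZ // -[in RHS]mulN1r -rsumZ; last exact: summableZ.
  rewrite -rsumD; [|exact: summableZ|by do 2!apply: summableZ].
  by congr rsum; apply/funext => i; rewrite cReM mulN1r.
rewrite cImM /= -!rsumZ // -rsumD; [|exact: summableZ|exact: summableZ].
by congr rsum; apply/funext => i; rewrite cImM.
Qed.

Lemma csummable_frob m (x y : forall i, 'M[C]_(m, k i)) :
  summable (fun i => nsq (x i)) -> summable (fun i => nsq (y i)) ->
  csummable (fun i => frob (x i) (y i)).
Proof.
move=> sx sy; split; apply: summable_le (summableD sx sy) => i /=.
  exact: cRe_frob_le.
exact: cIm_frob_le.
Qed.

Definition l2inner (x y : l2sum) : C := csum (fun i => frob (x i) (y i)).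

Lemma l2_frob (x y : l2sum) : csummable (fun i => frob (x i) (y i)).
Proof. apply: csummable_frob; exact: l2P. Qed.

Lemma l2innerDl (a : C) x y z :
  l2inner (a *: x + y) z = a * l2inner x z + l2inner y z.
Proof.
rewrite -csumZ; last exact: l2_frob.
rewrite -csumD; first by congr csum; apply/funext => i; rewrite frobDl frobZl.
  have := l2_frob (a *: x) z; congr csummable; apply/funext => i.
  by rewrite frobZl.
exact: l2_frob.
Qed.

Lemma l2inner_conj x y : l2inner y x = Num.conj (l2inner x y).
Proof.
rewrite conjE; apply: complex_eqP => /=.
  by congr rsum; apply/funext => i; rewrite frob_conj cRe_conj.
rewrite -mulN1r -rsumZ; last by have [] := l2_frob x y.
by congr rsum; apply/funext => i; rewrite frob_conj cIm_conj mulN1r.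
Qed.

Lemma l2innerXX (x : l2sum) : l2inner x x = (rsum (fun i => nsq (x i)))%:C.
Proof.
apply: complex_eqP => //=; rewrite -[RHS](@rsum0 R I).
by congr rsum; apply/funext => i; rewrite frobXX.
Qed.

Lemma l2inner_ge0 x : 0 <= l2inner x x.
Proof. by rewrite l2innerXX ler0c; apply: rsum_ge0 (l2P x) => i; exact: nsq_ge0. Qed.

Lemma nsq_le_l2 (x : l2sum) i : nsq (x i) <= Re (l2inner x x).
Proof.
rewrite l2innerXX /= -(psum1 (fun i => nsq (x i)) i).
by apply: psum_le_rsum (l2P x) => j; exact: nsq_ge0.
Qed.

Lemma l2inner_eq0 x : l2inner x x = 0 -> x = 0.
Proof.
move=> x0; apply: l2_inj => i; apply: nsq_eq0; apply/eqP.
by rewrite eq_le nsq_ge0 andbT (le_trans (nsq_le_l2 x i)) // x0.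
Qed.

Lemma coordinate_limit (u : nat -> l2sum) i :
  (forall e : R, 0 < e -> exists N, forall m n, (N <= m)%N -> (N <= n)%N ->
      Re (l2inner (u m - u n) (u m - u n)) <= e) ->
  exists v : 'rV[C]_(k i), forall e : R, 0 < e ->
    exists N, forall n, (N <= n)%N -> nsq (u n i - v) <= e.
Proof.
move=> cu.
(* [P] stands for the real or the imaginary part, so that one argument treats both. *)
have entry (P : C -> R) : (forall x y, P (x - y) = P x - P y) ->
    (forall x, P x ^+ 2 <= Re x ^+ 2 + Im x ^+ 2) -> forall a : 'I_(k i),
    exists l, forall e, 0 < e -> exists N, forall n, (N <= n)%N ->
      `|P (u n i 0 a) - l| <= e.
  move=> PB P2 a; apply: real_cauchy_cvg => e e0.
  have [N hN] := cu _ (exprn_gt0 2 e0); exists N => m n Nm Nn.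
  rewrite -(@ler_pXn2r _ 2) ?nnegrE ?(ltW e0) // real_normK ?num_real //.
  apply: le_trans (hN m n Nm Nn); apply: le_trans (nsq_le_l2 _ i).
  apply: le_trans (nsq_entry_le _ 0 a); rewrite -PB.
  by rewrite l2funD l2funN !mxE.
have [f hf] := choice (entry Re (@cReB R) (fun x => ltac:(by rewrite lerDl sqr_ge0))).
have [g hg] := choice (entry Im (@cImB R) (fun x => ltac:(by rewrite lerDr sqr_ge0))).
exists (\row_a Complex (f a) (g a)) => e e0.
under eq_exists do under eq_forall do rewrite nsqE big_ord1.
apply: null_sum e e0 => a e e0.
have s0 : 0 < Num.sqrt (e / 2) by rewrite sqrtr_gt0 divr_gt0.
have [N hN] := hf a _ s0; have [M hM] := hg a _ s0.
exists (maxn N M) => n; rewrite geq_max => /andP[/hN h1 /hM h2].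
rewrite !mxE cReB cImB /=.
have sq (x : R) : `|x| <= Num.sqrt (e / 2) -> x ^+ 2 <= e / 2.
  rewrite -(@ler_pXn2r _ 2) ?nnegrE ?sqrtr_ge0 // real_normK ?num_real //.
  by rewrite sqr_sqrtr // ltW // divr_gt0.
by have := sq _ h1; have := sq _ h2; lra.
Qed.

Lemma l2complete (u : nat -> l2sum) :
  (forall e : R, 0 < e -> exists N, forall m n, (N <= m)%N -> (N <= n)%N ->
      Num.sqrt (Re (l2inner (u m - u n) (u m - u n))) < e) ->
  exists l, forall e : R, 0 < e -> exists N, forall n, (N <= n)%N ->
      Num.sqrt (Re (l2inner (u n - l) (u n - l))) < e.
Proof.
move=> cu.
have {}cu e : 0 < e -> exists N, forall m n, (N <= m)%N -> (N <= n)%N ->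
    Re (l2inner (u m - u n) (u m - u n)) <= e.
  move=> e0; have se0 : 0 < Num.sqrt e by rewrite sqrtr_gt0.
  have [N hN] := cu _ se0; exists N => m n Nm Nn.
  by have := hN m n Nm Nn; rewrite ltr_sqrt // => /ltW.
pose L i := sval (cid (coordinate_limit i cu)).
have hL i (e : R) : 0 < e -> exists N, forall n, (N <= n)%N -> nsq (u n i - L i) <= e.
  exact: (svalP (cid (coordinate_limit i cu)) e).
(* For fixed [n] and a finite set [A], pick [m], depending on [A], with [u m] close to [L] on [A].
   The resulting bound does not depend on [A], hence controls the whole sum. *)
have tail e : 0 < e -> exists N, forall n, (N <= n)%N ->
    forall A, psum (fun i => nsq (u n i - L i)) A <= 4 * e.
  move=> e0; have [N hN] := cu e e0; exists N => n Nn A.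
  have [M hM] := null_sum (enum_fset A) hL e0.
  pose m := maxn N M.
  have h1 : psum (fun i => nsq ((u n - u m) i)) A <= e.
    apply: le_trans (hN n m Nn (leq_maxl _ _)); rewrite l2innerXX.
    by apply: psum_le_rsum (l2P _) => i; exact: nsq_ge0.
  have h2 : psum (fun i => nsq (u m i - L i)) A <= e := hM m (leq_maxr _ _).
  have : psum (fun i => nsq (u n i - L i)) A <=
      2 * psum (fun i => nsq ((u n - u m) i)) A +
      2 * psum (fun i => nsq (u m i - L i)) A.
    rewrite -!psumZ -psumD; apply: psum_le => i.
    have -> : u n i - L i = (u n - u m) i + (u m i - L i).
      by rewrite l2funD l2funN addrA subrK.
    exact: nsqD_le.
  move: (psum _ _) (psum _ _) (psum _ _) h1 h2 => *; lra.
have [N hN] := tail 1 ltr01.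
have sd n : (forall A, psum (fun i => nsq (u n i - L i)) A <= 4 * 1) ->
    summable (fun i => nsq (u n i - L i)).
  by apply: summable_nonneg => i; exact: nsq_ge0.
(* [L] is [u N] minus the square summable difference [u N - L]. *)
have sL : square_summable L.
  have sN := sd _ (hN N (leqnn _)).
  have := square_summableD (l2P (u N)) (square_summableZ (-1) sN).
  congr square_summable; apply: functional_extensionality_dep => i.
  by rewrite scaleN1r opprB addrC subrK.
exists (L2sum sL) => e e0.
have e80 : 0 < e ^+ 2 / 8 by rewrite divr_gt0 // exprn_gt0.
have [M hM] := tail _ e80; exists M => n /hM Mn.
rewrite -[ltRHS](ger0_norm (ltW e0)) -sqrtr_sqr ltr_sqrt ?exprn_gt0 //.
rewrite l2innerXX /=.
have : rsum (fun i => nsq ((u n - L2sum sL) i)) <= 4 * (e ^+ 2 / 8).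
  apply: rsum_le_bound (l2P _) _ => A; apply: le_trans (Mn A).
  by apply: psum_le => i; rewrite l2funD l2funN.
have := exprn_gt0 2 e0; move: (rsum _) (e ^+ 2) => *; lra.
Qed.

Definition l2hilbert : hilbert R :=
  Hilbert l2innerDl l2inner_conj l2inner_ge0 l2inner_eq0 l2complete.
End DirectSum.

(** * Block-diagonal operators *)

Section BlockOperators.
Local Open Scope complex_scope.
Variables (R : realType) (I : choiceType) (k : I -> nat).
Local Notation C := R[i].
Local Notation Re := (@complex.Re R).
Local Notation H := (l2hilbert R k).
Local Notation family := (forall i, 'rV[C]_(k i)).

(* Junk value [0] when [y] is not square summable. *)
Definition mkl2 (y : family) : l2sum R k :=
  if pselect (square_summable y) is left sy then L2sum sy else 0.

Lemma mkl2E y : square_summable y -> forall i, mkl2 y i = y i.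
Proof. by rewrite /mkl2; case: pselect. Qed.

Section Amplified.
Variable n : nat.
Implicit Types (x y : vecH H n) (T S : forall i, 'M[C]_(n, k i) -> 'M[C]_(n, k i)).

(** Identifies the [n]-fold sum of [H] with the l2-sum of the spaces of [n] by [k i] matrices, so
    that each block is a space with the Frobenius inner product. *)
Definition stack x i : 'M[C]_(n, k i) := \matrix_(p, a) (x p : l2sum R k) i 0 a.

Lemma row_stack x i p : row p (stack x i) = (x p : l2sum R k) i.
Proof. by apply/rowP => a; rewrite !mxE. Qed.

Lemma stack_inj x y : (forall i, stack x i = stack y i) -> x = y.
Proof.
move=> xy; apply/funext => p; apply: l2_inj => i.
by rewrite -!row_stack xy.
Qed.

Lemma stackP a x y i : stack (fun p => a *: x p + y p) i = a *: stack x i + stack y i.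
Proof. by apply/matrixP => p b; rewrite !mxE. Qed.

Lemma stackZD a x y i : stack (fun p => a *: (x p + y p)) i = a *: (stack x i + stack y i).
Proof. by apply/matrixP => p b; rewrite !mxE. Qed.

Lemma stackB x y i : stack (fun p => x p - y p) i = stack x i - stack y i.
Proof.
have -> : (fun p => x p - y p) = (fun p => -1 *: y p + x p).
  by apply/funext => p; rewrite scaleN1r addrC.
by rewrite stackP scaleN1r addrC.
Qed.

Lemma stack0 i : stack (fun=> 0) i = 0.
Proof. by apply/matrixP => p b; rewrite !mxE. Qed.

#[local] Opaque stack.

Lemma stack_summable x : summable (fun i => nsq (stack x i)).
Proof.
under eq_fun do rewrite nsq_rows.
apply: summable_sum => p; under eq_fun do rewrite row_stack.
exact: l2P.
Qed.

Lemma innernE x y : innern x y = csum (fun i => frob (stack x i) (stack y i)).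
Proof.
under eq_fun do rewrite frob_rows; rewrite csum_sum => [|p]; last first.
  by under eq_fun do rewrite !row_stack; exact: l2_frob.
by apply: eq_bigr => p _; under [in RHS]eq_fun do rewrite !row_stack.
Qed.

Lemma frob_summable x y : csummable (fun i => frob (stack x i) (stack y i)).
Proof. apply: csummable_frob; exact: stack_summable. Qed.

Lemma Re_innernE x y :
  Re (innern x y) = rsum (fun i => Re (frob (stack x i) (stack y i))).
Proof. by rewrite innernE. Qed.

Lemma Re_innern_sym x y : Re (innern x y) = Re (innern y x).
Proof.
by rewrite !Re_innernE; congr rsum; apply/funext => i; rewrite frob_conj cRe_conj.
Qed.

Lemma hnormnE x : hnormn x = Num.sqrt (rsum (fun i => nsq (stack x i))).
Proof. by rewrite /hnormn Re_innernE. Qed.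

Lemma rsum_nsq_ge0 x : 0 <= rsum (fun i => nsq (stack x i)).
Proof. by apply: rsum_ge0 (stack_summable x) => i; exact: nsq_ge0. Qed.

Definition blockop T : opn H n :=
  fun x p => mkl2 (fun i => row p (T i (stack x i))).

Definition block_bounded T (M : R) := forall i X, nsq (T i X) <= M * nsq X.

Lemma stack_blockop T M x i : block_bounded T M ->
  stack (blockop T x) i = T i (stack x i).
Proof.
move=> TM; apply/row_matrixP => p; rewrite row_stack mkl2E //.
apply: summable_le (summableZ M (stack_summable x)) => j.
by rewrite ger0_norm ?nsq_ge0 // (le_trans (nsq_row_le _ _)).
Qed.

#[local] Opaque blockop.

Lemma blockop_linear T M : block_bounded T M -> (forall i, linear (T i)) ->
  linear_opn (blockop T).
Proof.
move=> TM linT a x y; apply: stack_inj => i.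
have ex := stack_blockop x i TM; have ey := stack_blockop y i TM.
rewrite [LHS](stack_blockop _ i TM) [X in T i X]stackP [RHS]stackP linT.
exact: congr2 (congr1 _ (esym ex)) (esym ey).
Qed.

Lemma blockop_norm_le T (c : R) x : 0 <= c -> block_bounded T (c ^+ 2) ->
  hnormn (blockop T x) <= c * hnormn x.
Proof.
move=> c0 Tc; rewrite -[X in X * _](ger0_norm c0) -sqrtr_sqr !hnormnE.
rewrite -sqrtrM ?sqr_ge0 // ler_sqrt ?mulr_ge0 ?sqr_ge0 ?rsum_nsq_ge0 //.
rewrite -rsumZ; last exact: stack_summable.
apply: le_rsum => [i||]; last 2 first.
- exact: stack_summable.
- exact/summableZ/stack_summable.
by rewrite (stack_blockop _ _ Tc).
Qed.

Lemma blockop_bounded T (c : R) : 0 <= c -> block_bounded T (c ^+ 2) ->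
  (forall i, linear (T i)) -> bounded_opn (blockop T).
Proof.
move=> c0 Tc linT; split; first exact: blockop_linear Tc linT.
by exists c => x; exact: blockop_norm_le.
Qed.

Lemma blockop_ge0 T M : block_bounded T M -> (forall i X, 0 <= frob (T i X) X) ->
  forall x, 0 <= innern (blockop T x) x.
Proof.
move=> TM T0 x; rewrite innernE ge0_complexP /=.
have T0' i : 0 <= frob (stack (blockop T x) i) (stack x i).
  by rewrite (stack_blockop _ _ TM).
apply/andP; split.
  rewrite -(@rsum0 R I); apply/eqP; congr rsum; apply/funext => i.
  by have := T0' i; rewrite ge0_complexP => /andP[/eqP].
apply: rsum_ge0 => [i|]; last by have [] := frob_summable (blockop T x) x.
by have := T0' i; rewrite ge0_complexP => /andP[].
Qed.

Lemma blockop_adjoint T S M N : block_bounded T M -> block_bounded S N ->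
  (forall i X Y, frob (T i X) Y = frob X (S i Y)) ->
  is_adjoint (blockop T) (blockop S).
Proof.
move=> TM SN TS x y; rewrite !innernE; congr csum; apply/funext => i.
have ex := stack_blockop x i TM; have ey := stack_blockop y i SN.
apply: etrans (congr1 (fun X => frob X _) ex) _.
exact: etrans (TS i _ _) (congr1 (frob _) (esym ey)).
Qed.

End Amplified.

(** The transport along [i0 = i] is needed because the fibre depends on the index. *)
Definition delta_family i0 (v : 'rV[C]_(k i0)) : family := fun i =>
  if pselect (i0 = i) is left E then eq_rect i0 (fun i => 'rV[C]_(k i)) v i E else 0.

Lemma delta_familyE i0 (v : 'rV[C]_(k i0)) : delta_family v i0 = v.
Proof.
rewrite /delta_family; case: pselect => // E.
by rewrite (Prop_irrelevance E erefl).
Qed.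

Lemma delta_family0 i0 (v : 'rV[C]_(k i0)) i : i != i0 -> delta_family v i = 0.
Proof.
move=> /eqP ii0; rewrite /delta_family; case: pselect => // E.
by case: (ii0 (esym E)).
Qed.

Lemma delta_summable i0 (v : 'rV[C]_(k i0)) : square_summable (delta_family v).
Proof.
apply: (@summable_nonneg _ _ _ (nsq v)) => [i|A]; first exact: nsq_ge0.
have [iA|iA] := boolP (i0 \in A).
  rewrite /psum (big_fsetD1 i0) //= big_seq big1 ?addr0 ?delta_familyE // => i.
  by rewrite !inE => /andP[/delta_family0 -> _]; rewrite nsq0.
rewrite /psum big_seq big1 ?nsq_ge0 // => i iA'.
rewrite delta_family0 ?nsq0 //; by apply: contraNneq iA => <-.
Qed.

Definition embed n i0 (X : 'M[C]_(n, k i0)) : vecH H n :=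
  fun p => L2sum (delta_summable (row p X)).

Lemma stack_embed n i0 (X : 'M[C]_(n, k i0)) : stack (embed X) i0 = X.
Proof. by apply/row_matrixP => p; rewrite row_stack /= delta_familyE. Qed.

Lemma stack_embed0 n i0 (X : 'M[C]_(n, k i0)) i : i != i0 -> stack (embed X) i = 0.
Proof.
by move=> ii0; apply/row_matrixP => p; rewrite row_stack /= delta_family0 // row0.
Qed.

Lemma hnormn_embed n i0 (X : 'M[C]_(n, k i0)) : hnormn (embed X) = Num.sqrt (nsq X).
Proof.
rewrite hnormnE (rsum_support1 (i0 := i0)) ?stack_embed // => i ii0.
by rewrite stack_embed0 // nsq0.
Qed.

Lemma hnormn_blockop_embed n (T : forall i, 'M[C]_(n, k i) -> 'M[C]_(n, k i)) M
    i0 (X : 'M[C]_(n, k i0)) : block_bounded T M ->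
  hnormn (blockop T (embed X)) = Num.sqrt (nsq (T i0 X)).
Proof.
move=> TM; rewrite hnormnE (rsum_support1 (i0 := i0)) => [|i ii0].
  by rewrite (stack_blockop _ _ TM) stack_embed.
rewrite (stack_blockop _ _ TM) stack_embed0 //; apply/eqP.
by rewrite eq_le nsq_ge0 andbT (le_trans (TM _ _)) // nsq0 mulr0.
Qed.

(** The norm of a block-diagonal operator is the least uniform bound on its blocks. Vectors
    supported in one block show that the norm is itself such a bound. *)
Lemma opnorm_blockop n (T : forall i, 'M[C]_(n, k i) -> 'M[C]_(n, k i)) (c : R) :
  0 <= c -> (forall i, linear (T i)) -> block_bounded T (c ^+ 2) ->
  (forall d, 0 <= d -> block_bounded T (d ^+ 2) -> c <= d) ->
  opnorm (blockop T) = c.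
Proof.
move=> c0 linT Tc c_min; rewrite /opnorm.
set S := (X in sup X).
have S_le u : S u -> u <= c.
  move=> [x /= x1 <-]; apply: le_trans (blockop_norm_le x c0 Tc) _.
  by rewrite -[leRHS]mulr1 ler_wpM2l.
have embS i (X : 'M[C]_(n, k i)) : nsq X <= 1 -> Num.sqrt (nsq (T i X)) <= sup S.
  move=> X1; apply: ub_le_sup; first by exists c => u /S_le.
  exists (embed X); last exact: hnormn_blockop_embed Tc.
  by rewrite /= hnormn_embed -sqrtr1 ler_sqrt.
have S0 : S 0.
  exists (fun=> 0).
    by rewrite /= hnormnE; under eq_fun do rewrite stack0 nsq0; rewrite rsum0 sqrtr0 ler01.
  rewrite hnormnE; under eq_fun => i.
    rewrite (stack_blockop _ i Tc) stack0 (_ : T i 0 = 0) ?nsq0; first over.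
    by have := linT i (-1) 0 0; rewrite scaler0 addr0 scaleN1r addNr.
  by rewrite rsum0 sqrtr0.
apply/eqP; rewrite eq_le; apply/andP; split.
  by apply: ge_sup; [exists 0 | move=> u /S_le].
have supS0 : 0 <= sup S by apply: ub_le_sup => //; exists c => u /S_le.
apply: c_min => // i X.
have [/nsq_eq0 ->|X0] := eqVneq (nsq X) 0.
  by rewrite nsq0 mulr0; apply: le_trans (Tc _ _) _; rewrite nsq0 mulr0.
have X_gt0 : 0 < nsq X by rewrite lt_neqAle eq_sym X0 nsq_ge0.
(* Normalise [X] to a unit vector, apply the bound by the supremum, and scale back. *)
pose t := (Num.sqrt (nsq X))^-1.
have t2 : t ^+ 2 * nsq X = 1 by rewrite exprVn sqr_sqrtr ?nsq_ge0 // mulVf.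
have := embS i (t%:C *: X); rewrite nsqZ t2 => /(_ (lexx _)).
have TZ : T i (t%:C *: X) = t%:C *: T i X.
  have T0 : T i 0 = 0 by have := linT i (-1) 0 0; rewrite scaler0 addr0 scaleN1r addNr.
  by have := linT i t%:C X 0; rewrite addr0 T0 addr0.
rewrite TZ nsqZ -(@ler_pXn2r _ 2) ?nnegrE ?sqrtr_ge0 // sqr_sqrtr; last first.
  by rewrite mulr_ge0 ?sqr_ge0 ?nsq_ge0.
by rewrite exprVn sqr_sqrtr ?nsq_ge0 // ler_pdivrMl // mulrC.
Qed.

End BlockOperators.

(** * The representation *)

Section Representation.
Local Open Scope complex_scope.
Variables (R : realType) (Z : lmodType R[i]) (nu : forall n : nat, 'M[Z]_n -> R).
Hypothesis nu_gauge : matrix_gauge nu.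
Local Notation C := R[i].
Local Notation Re := (@complex.Re R).
Local Notation Im := (@complex.Im R).

Record contraction := Contraction {
  cdim : nat;
  cmap : Z -> 'M[C]_cdim;
  cmap_linear : linear cmap;
  cmapP : contractive nu cmap }.

(** [classic] supplies the choice structure required to form finite sets of admissible maps. *)
Local Notation index := {classic contraction}.
Definition idim (i : index) := cdim (i : contraction).
Local Notation H := (l2hilbert R idim).

Definition rep n (z : 'M[Z]_n) (i : index) : 'M[C]_(n, idim i) -> 'M[C]_(n, idim i) :=
  act (cmap i) z.

Lemma cmap0 (i : contraction) : cmap i 0 = 0.
Proof. by have := cmap_linear i (-1) 0 0; rewrite scaler0 addr0 scaleN1r addNr. Qed.
Lemma cmapZ (i : contraction) a z : cmap i (a *: z) = a *: cmap i z.
Proof. by have := cmap_linear i a z 0; rewrite addr0 cmap0 addr0. Qed.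
Lemma rep_linear n (z : 'M[Z]_n) i : linear (@rep n z i).
Proof. exact: act_linear. Qed.

Lemma rep_scale n (z z' : 'M[Z]_n) a i (X : 'M[C]_(n, idim i)) :
  (forall p q, z' p q = a *: z p q) -> rep z' X = a *: rep z X.
Proof.
move=> zz'; apply/row_matrixP => p; rewrite linearZ /= !row_act scaler_sumr.
by apply: eq_bigr => q _; rewrite zz' cmapZ scalemxAr.
Qed.

Lemma repN n (z : 'M[Z]_n) i (X : 'M[C]_(n, idim i)) : rep (- z) X = - rep z X.
Proof. by rewrite -scaleN1r; apply: rep_scale => p q; rewrite mxE scaleN1r. Qed.

Lemma rep_le n (z : 'M[Z]_n) i (X : 'M[C]_(n, idim i)) :
  Re (frob (rep z X) X) <= nu z * nsq X.
Proof. exact: cmapP. Qed.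

(** Each separating map is one of the summands, so a common bound on all forms bounds [nu z] up to a
    factor [d > 1] that can be taken arbitrarily close to [1]. *)
Lemma nu_le_of_rep n (z : 'M[Z]_n) c : 0 <= c ->
  (forall i (X : 'M[C]_(n, idim i)), Re (frob (rep z X) X) <= c * nsq X) -> nu z <= c.
Proof.
move=> c0 zc; case: n z zc => [|n] z zc.
  by rewrite (flatmx0 z) (nu0 nu_gauge).
rewrite -[c]mul1r; apply: le_mul_of_forall_gt => // d d1.
(* With this perturbation the separating vector has squared norm exactly [d]. *)
have d0 : 0 < (d - 1) / n.+1%:R by rewrite divr_gt0 // subr_gt0.
have [psi [linpsi cpsi [Y [zY nsqY]]]] := separating_map nu_gauge z (ltn0Sn n) d0.
have := zc (Contraction linpsi cpsi : index) Y.
rewrite nsqY divfK ?pnatr_eq0 // addrC subrK [c * d]mulrC.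
exact: le_trans.
Qed.

Lemma nu_eq0_of_rep n (z : 'M[Z]_n) :
  (forall i (X : 'M[C]_(n, idim i)), Re (frob (rep z X) X) <= 0) -> nu z = 0.
Proof.
move=> z0; apply: le_anti; apply/andP; split; last exact: nu_ge0.
by apply: nu_le_of_rep => // i X; rewrite mul0r.
Qed.

Definition offdiag n (z : 'M[Z]_n) : 'M[Z]_(n + n) := block_mx 0 (z *+ 2) 0 0.

Lemma frob_offdiag n (z : 'M[Z]_n) i (A B : 'M[C]_(n, idim i)) :
  Re (frob (rep (offdiag z) (col_mx A B)) (col_mx A B)) = 2 * Re (frob (rep z B) A).
Proof.
have -> : rep (offdiag z) (col_mx A B) = col_mx (rep (z *+ 2) B) 0.
  apply/row_matrixP => p; rewrite row_act big_split_ord /=.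
  rewrite -[p]splitK; case: (split p) => {}p /=.
    rewrite rowKu row_act [X in X + _]big1 ?add0r => [|q _].
      by apply: eq_bigr => q _; rewrite rowKd block_mxEur.
    by rewrite block_mxEul [X in cmap _ X]mxE cmap0 mulmx0.
  rewrite rowKd row0 !big1 ?addr0 // => q _.
    by rewrite block_mxEdr [X in cmap _ X]mxE cmap0 mulmx0.
  by rewrite block_mxEdl [X in cmap _ X]mxE cmap0 mulmx0.
rewrite frob_col_mx frob0l addr0 (@rep_scale _ z _ 2%:R%:C).
  by rewrite frobZl cReZ.
by move=> p q; rewrite mulr2n mxE rmorph_nat scaler_nat mulr2n.
Qed.

(** Admissibility for the corner matrix at the vector with components [t z X] and [X] is the
    hypothesis of [nsq_le_of_frob_le]. The bound is uniform in [i], so the direct sum is a bounded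
    operator. *)
Lemma rep_bounded n (z : 'M[Z]_n) : block_bounded (@rep n z) (nu (offdiag z) ^+ 2).
Proof.
move=> i X; apply: nsq_le_of_frob_le => [|t]; first exact: nu_ge0.
by rewrite -frob_offdiag -/(nsq _); have := rep_le (offdiag z) (col_mx (t%:C *: rep z X) X);
  rewrite /nsq frob_col_mx cReD.
Qed.

Definition phi (z : Z) (h : H) : H := mkl2 (fun i => (h : l2sum R idim) i *m cmap i z).

Lemma phiE z (h : H) i : (phi z h : l2sum R idim) i = (h : l2sum R idim) i *m cmap i z.
Proof.
(* Boundedness of the family at level one keeps the image square summable, so the default value in
   [mkl2] is not reached. *)
have act1 j (v : 'rV[C]_(idim j)) : rep (const_mx z : 'M_1) v = v *m cmap j z.
  by apply/row_matrixP => p; rewrite row_act big_ord1 mxE !ord1 !row_id.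
rewrite mkl2E //; apply: square_summable_le (l2P (h : l2sum R idim)) => j.
by rewrite -act1; exact: rep_bounded.
Qed.

(** Amplification commutes with the direct sum; this reduces every claim on [phi] to its blocks. *)
Lemma ampl_phi n (z : 'M[Z]_n) : ampl phi z = blockop (@rep n z).
Proof.
apply/funext => x; apply: stack_inj => i.
rewrite (stack_blockop x i (@rep_bounded n z)); apply/row_matrixP => p.
rewrite row_stack row_act l2fun_sum; apply: eq_bigr => q _.
by rewrite row_stack; exact: phiE.
Qed.

Lemma phi_linear a z w : phi (a *: z + w) = (fun h => a *: phi z h + phi w h).
Proof.
apply/funext => h; apply: l2_inj => i; apply: etrans (phiE _ _ _) _.
rewrite (cmap_linear i) mulmxDr -scalemxAr.
by rewrite -(phiE z h i) -(phiE w h i).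
Qed.

Lemma hnormn1 (h : H) : hnormn (fun _ : 'I_1 => h) = hnorm h.
Proof. by rewrite /hnormn /innern big_ord1. Qed.

Lemma phi_bounded z : bounded_op (phi z).
Proof.
split=> [a x y|].
  apply: l2_inj => i; apply: etrans (phiE _ _ _) _.
  rewrite [l2fun _ _]/(a *: (x : l2sum R idim) i + (y : l2sum R idim) i).
  by rewrite mulmxDl -scalemxAl -(phiE z x i) -(phiE z y i).
exists (nu (offdiag (const_mx z : 'M_1))) => h.
rewrite -!hnormn1.
have <- : ampl phi (const_mx z : 'M_1) (fun=> h) = (fun=> phi z h).
  by apply/funext => p; rewrite /ampl /mx_act big_ord1 mxE.
rewrite ampl_phi; apply: blockop_norm_le; first exact: nu_ge0.
exact: rep_bounded.
Qed.

Lemma rep_adjoint n (z : 'M[Z]_n) :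
  exists S : forall i, 'M[C]_(n, idim i) -> 'M[C]_(n, idim i),
    [/\ forall i, linear (S i), block_bounded S (nu (offdiag z) ^+ 2) &
        forall i X Y, frob (rep z X) Y = frob X (S i Y)].
Proof.
have adj i := adjoint_exists (@rep_linear n z i).
exists (fun i => s2val (cid2 (adj i))); split=> i.
- exact: s2valP (cid2 (adj i)).
- apply: adjoint_nsq_le (@rep_bounded n z i) _; first exact: nu_ge0.
  exact: s2valP' (cid2 (adj i)).
- exact: s2valP' (cid2 (adj i)).
Qed.

Section RealPart.
Variables (n : nat) (z : 'M[Z]_n).
Variable S : forall i, 'M[C]_(n, idim i) -> 'M[C]_(n, idim i).
Hypotheses (linS : forall i, linear (@S i))
  (S_bounded : block_bounded S (nu (offdiag z) ^+ 2))
  (S_adj : forall i (X Y : 'M[C]_(n, idim i)), frob (rep z X) Y = frob X (S Y)).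

Definition re_rep i (X : 'M[C]_(n, idim i)) := 2^-1 *: (rep z X + S X).

Lemma re_rep_linear i : linear (@re_rep i).
Proof.
move=> a X Y; rewrite /re_rep (rep_linear z) linS.
rewrite addrACA -[a *: _ + a *: _]scalerDr [LHS]scalerDr !scalerA.
by rewrite [a * _]mulrC.
Qed.

Lemma halfE : 2^-1 = (2^-1 : R)%:C :> C.
Proof. by rewrite fmorphV rmorph_nat. Qed.

Lemma re_rep_selfadj i (X Y : 'M[C]_(n, idim i)) :
  frob (re_rep X) Y = frob X (re_rep Y).
Proof.
have S_adj' : frob (S X) Y = frob X (rep z Y) by rewrite frob_conj -S_adj -frob_conj.
rewrite frobZl frobZr frobDl frobDr S_adj S_adj' addrC; congr (_ * _).
by rewrite halfE conj_real.
Qed.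

Lemma Re_frob_re_rep i (X : 'M[C]_(n, idim i)) :
  Re (frob (re_rep X) X) = Re (frob (rep z X) X).
Proof.
rewrite frobZl halfE cReZ frobDl cReD S_adj [frob (S X) X]frob_conj -S_adj cRe_conj.
by rewrite S_adj; move: (Re _) => r; lra.
Qed.

Lemma re_rep_bounded : block_bounded re_rep (nu (offdiag z) ^+ 2).
Proof.
move=> i X; rewrite /re_rep halfE nsqZ.
have := nsqD_le (rep z X) (S X); have := rep_bounded z X; have := S_bounded X.
rewrite expr2; move: (nsq _) (nsq _) (nsq _) (_ * nsq X) => *; lra.
Qed.

Lemma ReOp_blockop : ReOp (blockop (@rep n z)) (blockop S) = blockop re_rep.
Proof.
apply/funext => x; apply: stack_inj => i.
apply: etrans (stackZD _ _ _ i) (etrans _ (esym (stack_blockop x i re_rep_bounded))).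
apply: (congr1 (fun A => 2^-1 *: A)); apply: congr2.
  exact: stack_blockop x i (@rep_bounded n z).
exact: stack_blockop x i S_bounded.
Qed.

Lemma rep_ge n' (w : 'M[Z]_n') i (X : 'M[C]_(n', idim i)) :
  - nu (- w) * nsq X <= Re (frob (rep w X) X).
Proof. by have := rep_le (- w) X; rewrite repN frobNl cReN mulNr lerNl. Qed.

End RealPart.

(** Each block of the real part has its form between [- nu (- z)] and [nu z], so the blockwise
    Jordan decompositions are uniformly bounded and sum to one for the whole operator. *)
Lemma ampl_phi_gauge n (z : 'M[Z]_n) : re_pos_norm_eq (ampl phi z) (nu z).
Proof.
have [S [linS S_bd S_adj]] := rep_adjoint z.
have bounds i (X : 'M[C]_(n, idim i)) :
    - nu (- z) * nsq X <= Re (frob (re_rep z S X) X) <= nu z * nsq X.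
  by rewrite (Re_frob_re_rep S_adj) rep_ge rep_le.
have [P [N PN]] : exists P N : forall i, 'M[C]_(n, idim i) -> 'M[C]_(n, idim i),
    forall i, jordan_decomposition (@re_rep n z S i) (P i) (N i) (nu (- z)) (nu z).
  have ex i := jordan_decomposition_exists (nu_ge0 nu_gauge (- z)) (nu_ge0 nu_gauge z)
    (re_rep_linear z linS (i:=i)) (re_rep_selfadj S_adj (i:=i)) (bounds i).
  exists (fun i => sval (cid (ex i))), (fun i => sval (cid (svalP (cid (ex i))))) => i.
  exact: svalP (cid (svalP (cid (ex i)))).
have linP i : linear (P i) by have [[]] := PN i.
have linN i : linear (N i) by have [[]] := PN i.
have P_bd : block_bounded P (nu z ^+ 2) by move=> i; have [] := PN i.
have N_bd : block_bounded N (nu (- z) ^+ 2) by move=> i; have [] := PN i.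
exists (blockop S); rewrite ampl_phi; split.
  exact: blockop_adjoint (@rep_bounded n z) S_bd S_adj.
rewrite (ReOp_blockop S_bd).
exists (blockop P); split; last first.
  apply: opnorm_blockop => // [|d d0 Pd]; first exact: nu_ge0.
  (* A bound [d] on the blocks of [P] bounds the forms of [P - N], as [N >= 0]; hence
     [nu z <= d]. *)
  apply: nu_le_of_rep => // i X; rewrite -(Re_frob_re_rep S_adj).
  have [_ /(_ X)[-> _] /(_ X)[_ N0] _ _] := PN i.
  rewrite frobBl cReB.
  have := frob_le_of_nsq_le X d0 (Pd i X).
  move: N0; rewrite ge0_complexP => /andP[_]; move: (Re _) (Re _) (nsq X) => *; lra.
exists (blockop N); split.
- split; first by apply: blockop_bounded P_bd linP; exact: nu_ge0.
  by apply: blockop_ge0 P_bd _ => i X; have [_ _ /(_ X)[]] := PN i.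
- split; first by apply: blockop_bounded N_bd linN; exact: nu_ge0.
  by apply: blockop_ge0 N_bd _ => i X; have [_ _ /(_ X)[]] := PN i.
- move=> x; apply: stack_inj => i.
  apply: etrans (stack_blockop x i (re_rep_bounded S_bd)) _.
  apply: etrans _ (esym (stackB _ _ i)).
  have [_ /(_ (stack x i))[-> _] _ _ _] := PN i.
  exact: congr2 (esym (stack_blockop x i P_bd)) (congr1 _ (esym (stack_blockop x i N_bd))).
- move=> x; apply: stack_inj => i.
  apply: etrans (stack_blockop _ i P_bd) _.
  apply: etrans (congr1 (P i) (stack_blockop x i N_bd)) _.
  by rewrite stack0; have [_ /(_ (stack x i))[_ ->]] := PN i.
Qed.

Lemma ampl_phi_norm n (z : 'M[Z]_n) : opnorm (ampl phi z) = nu (offdiag z).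
Proof.
rewrite ampl_phi; apply: opnorm_blockop.
- exact: nu_ge0.
- exact: rep_linear.
- exact: rep_bounded.
(* A uniform bound [d] on the blocks bounds the form of the corner matrix at any vector, split into
   its upper and lower halves. *)
move=> d d0 zd; apply: nu_le_of_rep => // i X.
rewrite -[X]vsubmxK frob_offdiag.
have := frob_le_of_nsq_le (usubmx X) d0 (zd i (dsubmx X)).
by rewrite {2}/nsq -cReD -frob_col_mx.
Qed.

Lemma phi_injective : C_proper nu -> injective phi.
Proof.
move=> proper z w zw; apply/eqP; rewrite -subr_eq0; apply/eqP.
have phi0 h : phi (z - w) h = 0.
  by rewrite addrC -scaleN1r phi_linear zw scaleN1r addNr.
apply: proper => j _; apply: nu_eq0_of_rep => i X.
suff -> : rep (const_mx ('i%C ^+ j *: (z - w)) : 'M_1) X = 0 by rewrite frob0l.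
apply/row_matrixP => p; rewrite row_act big_ord1 mxE cmapZ -scalemxAr row0.
(* Applying [phi (z - w) = 0] to the row [X] placed in summand [i] shows that [cmap i (z - w)] kills
   it. *)
have := phiE (z - w) (embed X ord0) i; rewrite phi0 /= delta_familyE => <-.
exact: scaler0.
Qed.

Lemma accretive_of_nu n (z : 'M[Z]_n) : nu (- z) = 0 -> accretive (ampl phi z).
Proof.
move=> z0; have [S [linS S_bd S_adj]] := rep_adjoint z.
exists (blockop S); rewrite ampl_phi; split.
  exact: blockop_adjoint (@rep_bounded n z) S_bd S_adj.
rewrite (ReOp_blockop S_bd); split.
  apply: blockop_bounded (re_rep_bounded S_bd) _; first exact: nu_ge0.
  exact: re_rep_linear.
apply: blockop_ge0 (re_rep_bounded S_bd) _ => i X.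
rewrite ge0_complexP (Re_frob_re_rep S_adj); apply/andP; split.
  have /(congr1 Im) := re_rep_selfadj S_adj X X.
  by rewrite [in RHS]frob_conj cIm_conj => h; apply/eqP; move: (Im _) h => r h; lra.
by have := rep_ge z X; rewrite z0 oppr0 mul0r.
Qed.

(** The adjoint [S] is arbitrary and not known to be block diagonal, so only its pairing with a
    vector supported in block [i] is used. *)
Lemma nu_of_accretive n (z : 'M[Z]_n) : accretive (ampl phi z) -> nu (- z) = 0.
Proof.
move=> [S [adjS [_ posS]]]; apply: nu_eq0_of_rep => i X; rewrite repN frobNl cReN oppr_le0.
pose x := embed X.
have form (y : vecH H n) : Re (innern y x) = Re (frob (stack y i) X).
  rewrite Re_innernE (rsum_support1 (i0 := i)) ?stack_embed // => j ji.
  by rewrite stack_embed0 // frob_conj frob0l rmorph0.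
have rep_x : stack (ampl phi z x) i = rep z X.
  by rewrite ampl_phi (stack_blockop x i (@rep_bounded n z)) stack_embed.
have S_x : Re (frob (stack (S x) i) X) = Re (frob (rep z X) X).
  by rewrite -form -rep_x -form adjS Re_innern_sym.
have := posS x; rewrite ge0_complexP form stackZD => /andP[_].
by rewrite frobZl halfE cReZ frobDl cReD S_x rep_x; move: (Re _) => r; lra.
Qed.

End Representation.

Theorem theorem4p8 (R : realType) (Z : lmodType R[i])
    (nu : forall n : nat, 'M[Z]_n -> R) :
  matrix_gauge nu -> C_proper nu ->
  exists (H : hilbert R) (phi : Z -> H -> H),
    [/\ (* phi is a linear map Z -> B(H) *)
        (forall (a : R[i]) (z w : Z),
            phi (a *: z + w) = (fun h => a *: phi z h + phi w h)),
        (forall z, bounded_op (phi z)),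
        (* completely gauge isometric *)
        (forall n (z : 'M[Z]_n), re_pos_norm_eq (ampl phi z) (nu n z)),
        (* (i) completely isometric for ||z||_n = nu_2n([0 2z; 0 0]) *)
        (forall n (z : 'M[Z]_n),
            opnorm (ampl phi z) = nu (n + n)%N (block_mx 0 (z *+ 2) 0 0)) &
        (* (ii) real-complete order embedding *)
        [/\ injective phi,
            (forall n (z : 'M[Z]_n), nu n (- z) = 0 -> accretive (ampl phi z)) &
            (forall n (z : 'M[Z]_n), accretive (ampl phi z) -> nu n (- z) = 0)]].
Proof.
move=> nu_gauge proper.
exists (l2hilbert R (@idim R Z nu)), (@phi R Z nu); split.
- exact: phi_linear.
- exact: phi_bounded.
- exact: ampl_phi_gauge.
- exact: ampl_phi_norm.
- split.
  + exact: phi_injective.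
  + exact: accretive_of_nu.
  + exact: nu_of_accretive.
Qed.
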